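(* The following problem is PSPACE-hard, with complexity measured in the syntactic size of the input: given a boolean program $M$ (possibly with loops) and a rational number $q$, decide whether $SE[U](M)>q$.
   Context: Boolean programs have the syntax $M ::= x:=\psi \mid M_0;M_1 \mid \mathsf{if}\ \psi\ \mathsf{then}\ M_0\ \mathsf{else}\ M_1 \mid \mathsf{while}\ \psi\ \mathsf{do}\ M \mid \mathsf{skip}$, with expressions $\phi,\psi ::= \mathsf{true}\mid x\mid\phi\wedge\psi\mid\neg\phi$. All variables are boolean, and the semantics is the standard deterministic one. The high input $H$ is the tuple of initial values of designated high input variables, ranging over all their boolean assignments. The low output $M(h)$ on input $h$ is the sequence of values of designated low variables along the execution, where $\bot$ marks termination. Observation is termination-insensitive: $M(h)=o$ iff for all $i$, $o_i=\bot$ or $M(h)_i=\bot$ or $o_i=M(h)_i$. $U$ is the uniform distribution on inputs, and $\mu(O=o)=\sum_{h:M(h)=o}\mu(H=h)$, with conditional probabilities induced accordingly. Logarithms are base 2. - $\mathcal{H}[\mu](X)=\sum_x\mu(X=x)\log\frac1{\mu(X=x)}$. - $\mathcal{H}[\mu](Y|Z)=\sum_z\mu(Z=z)\sum_y\mu(Y=y|Z=z)\log\frac1{\mu(Y=y|Z=z)}$. - $SE[\mu](M)=\mathcal{H}[\mu](H)-\mathcal{H}[\mu](H|O)$. *)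

(* Defs.v *)
From Stdlib Require Import Reals QArith Qreals List ClassicalEpsilon.
Import ListNotations.
Open Scope nat_scope.

Inductive bexpr : Type :=
| BTrue : bexpr
| BVar  : nat -> bexpr
| BAnd  : bexpr -> bexpr -> bexpr
| BNot  : bexpr -> bexpr.

Inductive bprog : Type :=
| PAssign : nat -> bexpr -> bprog
| PSeq    : bprog -> bprog -> bprog
| PIf     : bexpr -> bprog -> bprog -> bprog
| PWhile  : bexpr -> bprog -> bprog
| PSkip   : bprog.

Definition state := nat -> bool.

Fixpoint beval (e : bexpr) (s : state) : bool :=
  match e with
  | BTrue => true
  | BVar x => s x
  | BAnd a b => andb (beval a s) (beval b s)
  | BNot a => negb (beval a s)
  end.

Definition upd (s : state) (x : nat) (v : bool) : state :=
  fun y => if Nat.eqb y x then v else s y.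

Fixpoint step (M : bprog) (s : state) : option (bprog * state) :=
  match M with
  | PSkip => None
  | PAssign x e => Some (PSkip, upd s x (beval e s))
  | PSeq PSkip M1 => Some (M1, s)
  | PSeq M0 M1 =>
      match step M0 s with
      | Some (M0', s') => Some (PSeq M0' M1, s')
      | None => None
      end
  | PIf e M0 M1 => Some (if beval e s then M0 else M1, s)
  | PWhile e M0 => Some (PIf e (PSeq M0 (PWhile e M0)) PSkip, s)
  end.

Fixpoint run (M : bprog) (s : state) (n : nat) : option (bprog * state) :=
  match n with
  | O => Some (M, s)
  | Datatypes.S n' => match run M s n' with
            | Some (M', s') => step M' s'
            | None => None
            end
  end.

Record instance : Type := mkInstance {
  i_prog : bprog;
  i_high : list nat;
  i_low  : list nat;
  i_q    : Q }.

Definition valid_instance (I : instance) : Prop :=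
  NoDup (i_high I) /\ NoDup (i_low I).

(* high input h: a boolean assignment to the high variables, as a list
   aligned with [i_high]; all other variables are initially false. *)
Fixpoint init_state (high : list nat) (h : list bool) : state :=
  match high, h with
  | x :: hs, b :: bs => fun y => if Nat.eqb y x then b else init_state hs bs y
  | _, _ => fun _ => false
  end.

Fixpoint all_inputs (n : nat) : list (list bool) :=
  match n with
  | O => [ [] ]
  | Datatypes.S n' => map (cons false) (all_inputs n') ++ map (cons true) (all_inputs n')
  end.

(* low output sequence; [None] plays the role of bottom (termination) *)
Definition obs := nat -> option (list bool).

Definition output (I : instance) (h : list bool) : obs :=
  fun i => match run (i_prog I) (init_state (i_high I) h) i with
           | Some (_, s) => Some (map s (i_low I))
           | None => None
           end.

(* termination-insensitive matching: M(h) = o *)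
Definition obs_match (t o : obs) : Prop :=
  forall i, o i = None \/ t i = None \/ o i = t i.

Definition ind (P : Prop) : R :=
  if excluded_middle_informative P then 1%R else 0%R.

Definition log2 (x : R) : R := (ln x / ln 2)%R.

(* p log (1/p), with the usual convention 0 log (1/0) = 0 *)
Definition ent (p : R) : R :=
  if Req_dec_T p 0 then 0%R else (p * log2 (/ p))%R.

Definition sumR {A} (l : list A) (f : A -> R) : R :=
  fold_right (fun a acc => (f a + acc)%R) 0%R l.

Section SE.
Variable I : instance.

Definition inputs := all_inputs (length (i_high I)).

Definition muU (h : list bool) : R := (/ (2 ^ length (i_high I)))%R.

Definition muO (o : obs) : R :=
  sumR inputs (fun h => (ind (obs_match (output I h) o) * muU h)%R).

Definition muH_given_O (h : list bool) (o : obs) : R :=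
  ((ind (obs_match (output I h) o) * muU h) / muO o)%R.

Definition entropy_H : R := sumR inputs (fun h => ent (muU h)).

(* H[U](H | O), the outer sum ranging over the distinct low outputs
   o in { M(h) | h }; each distinct value o is counted once by weighting
   the input h with 1 / #{h' | M(h') = M(h)}. *)
Definition entropy_H_given_O : R :=
  sumR inputs (fun h =>
    let o := output I h in
    ((/ sumR inputs (fun h' => ind (output I h' = o))) *
     (muO o * sumR inputs (fun h' => ent (muH_given_O h' o))))%R).

Definition SE : R := (entropy_H - entropy_H_given_O)%R.
End SE.

(* Encoding of instances as bit strings (syntactic size, up to a       *)
(* polynomial): prefix-free, binary numerals.                          *)

Fixpoint pos_bits (p : positive) : list bool :=
  match p with
  | xH => []
  | xO p' => pos_bits p' ++ [false]
  | xI p' => pos_bits p' ++ [true]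
  end.

(* self-delimiting: each bit b as [true; b], then a terminating false *)
Definition enc_bits (l : list bool) : list bool :=
  flat_map (fun b => [true; b]) l ++ [false].

Definition enc_nat (n : nat) : list bool :=
  match n with
  | O => [false]
  | Datatypes.S _ => true :: enc_bits (pos_bits (Pos.of_nat n))
  end.

Definition enc_Z (z : Z) : list bool :=
  match z with
  | Z0 => [false; false]
  | Zpos p => [false; true] ++ enc_bits (pos_bits p)
  | Zneg p => [true] ++ enc_bits (pos_bits p)
  end.

Definition enc_Q (q : Q) : list bool :=
  enc_Z (Qnum q) ++ enc_bits (pos_bits (Qden q)).

Fixpoint enc_bexpr (e : bexpr) : list bool :=
  match e with
  | BTrue => [false; false]
  | BVar x => [false; true] ++ enc_nat x
  | BAnd a b => [true; false] ++ enc_bexpr a ++ enc_bexpr b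
  | BNot a => [true; true] ++ enc_bexpr a
  end.

Fixpoint enc_bprog (M : bprog) : list bool :=
  match M with
  | PAssign x e => [false; false; false] ++ enc_nat x ++ enc_bexpr e
  | PSeq M0 M1 => [false; false; true] ++ enc_bprog M0 ++ enc_bprog M1
  | PIf e M0 M1 => [false; true; false] ++ enc_bexpr e ++ enc_bprog M0 ++ enc_bprog M1
  | PWhile e M0 => [false; true; true] ++ enc_bexpr e ++ enc_bprog M0
  | PSkip => [true; false; false]
  end.

Definition enc_natlist (l : list nat) : list bool :=
  flat_map (fun n => true :: enc_nat n) l ++ [false].

Definition enc_instance (I : instance) : list bool :=
  enc_bprog (i_prog I) ++ enc_natlist (i_high I) ++ enc_natlist (i_low I)
  ++ enc_Q (i_q I).

Definition SE_gt_problem (w : list bool) : Prop :=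
  exists I, valid_instance I /\ enc_instance I = w /\ (SE I > Q2R (i_q I))%R.

Inductive sym : Type := Blank | S0 | S1.
Inductive dir : Type := DL | DR | DN.

Record TM : Type := mkTM {
  tm_nstates : nat;                           (* states are 0 .. nstates-1 *)
  tm_delta : nat -> sym -> nat * sym * dir;
  tm_start : nat;
  tm_accept : nat;
  tm_reject : nat }.

Definition tm_wf (T : TM) : Prop :=
  tm_start T < tm_nstates T /\ tm_accept T < tm_nstates T /\
  tm_reject T < tm_nstates T /\
  forall q a, q < tm_nstates T -> fst (fst (tm_delta T q a)) < tm_nstates T.

Record config : Type := mkConfig {
  c_state : nat; c_left : list sym; c_cur : sym; c_right : list sym }.

Definition sym_of_bool (b : bool) : sym := if b then S1 else S0.

Definition init_config (T : TM) (x : list bool) : config :=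
  match map sym_of_bool x with
  | [] => mkConfig (tm_start T) [] Blank []
  | a :: r => mkConfig (tm_start T) [] a r
  end.

Definition halted (T : TM) (c : config) : Prop :=
  c_state c = tm_accept T \/ c_state c = tm_reject T.

Definition tm_step (T : TM) (c : config) : config :=
  if orb (Nat.eqb (c_state c) (tm_accept T)) (Nat.eqb (c_state c) (tm_reject T))
  then c
  else
    match tm_delta T (c_state c) (c_cur c) with
    | (q', a, DN) => mkConfig q' (c_left c) a (c_right c)
    | (q', a, DR) =>
        match c_right c with
        | [] => mkConfig q' (a :: c_left c) Blank []
        | b :: r => mkConfig q' (a :: c_left c) b r
        end
    | (q', a, DL) =>
        match c_left c with
        | [] => mkConfig q' [] Blank (a :: c_right c)
        | b :: l => mkConfig q' l b (a :: c_right c)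
        end
    end.

Fixpoint tm_run (T : TM) (c : config) (n : nat) : config :=
  match n with O => c | Datatypes.S n' => tm_step T (tm_run T c n') end.

Definition space (c : config) : nat := length (c_left c) + 1 + length (c_right c).

Fixpoint bits_until_blank (l : list sym) : list bool :=
  match l with
  | S0 :: r => false :: bits_until_blank r
  | S1 :: r => true :: bits_until_blank r
  | _ => []
  end.

Definition tm_output (c : config) : list bool := bits_until_blank (c_cur c :: c_right c).

Definition poly_bound (c k n : nat) : nat := c * n ^ k + c.

Definition in_PSPACE (L : list bool -> Prop) : Prop :=
  exists (T : TM) (c k : nat), tm_wf T /\
    forall x,
      (forall t, space (tm_run T (init_config T x) t) <= poly_bound c k (length x)) /\
      exists t, halted T (tm_run T (init_config T x) t) /\
        (c_state (tm_run T (init_config T x) t) = tm_accept T <-> L x).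

Definition poly_time_computable (f : list bool -> list bool) : Prop :=
  exists (T : TM) (c k : nat), tm_wf T /\
    forall x, exists t, t <= poly_bound c k (length x) /\
      halted T (tm_run T (init_config T x) t) /\
      tm_output (tm_run T (init_config T x) t) = f x.

Definition PSPACE_hard (P : list bool -> Prop) : Prop :=
  forall L, in_PSPACE L ->
    exists f, poly_time_computable f /\ forall x, L x <-> P (f x).

(* Main.v *)
From Stdlib Require Import Reals QArith List Lia Lra ClassicalEpsilon FunctionalExtensionality Arith.
Require Import Defs.
Import ListNotations.
Open Scope nat_scope.

(** A Turing machine deciding a language in space S(n) is simulated by a boolean
    program with S(n) variables per tape bit, which finally copies the one-bit
    secret to the public variable iff the machine accepted.  Both secrets give
    equally long runs, so SE is 1 or 0, and the threshold is q = 0.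
    The program keeps the tape as a ring with the head at a fixed cell and
    rotates it; one pass through uniform blocks, the j-th one touching only the
    cells j and j + 1, rotates it either way.  Variable names being unary, the
    program is a constant prefix, a sequence of copies of a constant-size
    template with slots filled by 1^j, and a constant suffix.  Such a word
    arises from the input by repeated sweeps of a finite transducer: each sweep
    marks one header and adds a digit to every later slot.  The same sweeps
    multiply a unary padding by n + 1, which yields polynomially many blocks.
    A one-tape machine performs a sweep in quadratic time. *)

(** * Encodings and the entropy of one secret bit *)

(** The low output is indexed by execution steps, so timing is observable. The secret must therefore
    stay out of all control flow; it is read once, at the end, behind a guard that does not depend
    on it. Polynomial time means here an explicit one-tape machine, and this requirement shapes the
    program. A head moving over the cells would need code that relates its position to every cell.
    With the head fixed, the transition table occurs once, in code of constant size, and the code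
    for a cell only transports symbols. Binary indices would call for a counter with carries,
    whereas a unary index grows by the insertion of letters, which a device with finitely many
    states can do. Polynomially many blocks, too, come from marking headers instead of computing a
    number. *)

Lemma pos_bits_inj p p' : pos_bits p = pos_bits p' -> p = p'.
Proof.
  revert p'; induction p as [p IH|p IH|]; intros [p'|p'|] H; simpl in H; try reflexivity;
    try (apply app_inj_tail in H; destruct H as [H Hb]; try discriminate; f_equal; auto);
    try (symmetry in H; apply app_eq_nil in H; destruct H; discriminate);
    try (apply app_eq_nil in H; destruct H; discriminate).
Qed.

(** The arbitrary remainders [r] and [r'] let unique decoding compose along concatenations. *)
Lemma enc_bits_prefix l l' r r' : enc_bits l ++ r = enc_bits l' ++ r' -> l = l' /\ r = r'.
Proof.
  unfold enc_bits; revert l'; induction l as [|b l IH]; intros [|b' l'] H; simpl in H; inversion H; auto.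
  destruct (IH _ H2); subst; auto.
Qed.

Lemma enc_nat_prefix n n' r r' : enc_nat n ++ r = enc_nat n' ++ r' -> n = n' /\ r = r'.
Proof.
  destruct n as [|n], n' as [|n']; simpl; intros H; inversion H; auto.
  apply enc_bits_prefix in H1; destruct H1 as [H1 ?]; split; auto.
  apply pos_bits_inj in H1. apply (f_equal Pos.to_nat) in H1.
  change (Pos.to_nat (Pos.of_nat (S n)) = Pos.to_nat (Pos.of_nat (S n'))) in H1.
  rewrite !Nat2Pos.id in H1; auto.
Qed.

Lemma enc_Z_prefix z z' r r' : enc_Z z ++ r = enc_Z z' ++ r' -> z = z' /\ r = r'.
Proof.
  destruct z, z'; simpl; intros H; inversion H; auto;
    apply enc_bits_prefix in H1; destruct H1 as [H1 ?]; apply pos_bits_inj in H1; subst; auto.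
Qed.

Lemma enc_bexpr_prefix e : forall e' r r', enc_bexpr e ++ r = enc_bexpr e' ++ r' -> e = e' /\ r = r'.
Proof.
  induction e as [|x|a IHa b IHb|a IHa]; intros [|x'|a' b'|a'] r r' H; simpl in H; inversion H; auto.
  - apply enc_nat_prefix in H1; destruct H1; subst; auto.
  - rewrite <- !app_assoc in H1. apply IHa in H1; destruct H1 as [? H1].
    apply IHb in H1; destruct H1; subst; auto.
  - apply IHa in H1; destruct H1; subst; auto.
Qed.

Lemma enc_bprog_prefix M : forall M' r r', enc_bprog M ++ r = enc_bprog M' ++ r' -> M = M' /\ r = r'.
Proof.
  induction M as [x e|M0 IH0 M1 IH1|e M0 IH0 M1 IH1|e M0 IH0|];
    intros [x' e'|M0' M1'|e' M0' M1'|e' M0'|] r r' H; simpl in H; inversion H as [H1]; auto;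
    rewrite <- ?app_assoc in H1.
  - apply enc_nat_prefix in H1; destruct H1 as [? H1]; apply enc_bexpr_prefix in H1; destruct H1; subst; auto.
  - apply IH0 in H1; destruct H1 as [? H1]; apply IH1 in H1; destruct H1; subst; auto.
  - apply enc_bexpr_prefix in H1; destruct H1 as [? H1].
    apply IH0 in H1; destruct H1 as [? H1]; apply IH1 in H1; destruct H1; subst; auto.
  - apply enc_bexpr_prefix in H1; destruct H1 as [? H1].
    apply IH0 in H1; destruct H1; subst; auto.
Qed.

Lemma enc_natlist_prefix l : forall l' r r', enc_natlist l ++ r = enc_natlist l' ++ r' -> l = l' /\ r = r'.
Proof.
  unfold enc_natlist; induction l as [|n l IH]; intros [|n' l'] r r' H; simpl in H; inversion H as [H1]; auto.
  rewrite <- !app_assoc in H1. apply enc_nat_prefix in H1; destruct H1 as [? H1].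
  rewrite !app_assoc in H1. apply IH in H1; destruct H1; subst; auto.
Qed.

(** [SE_gt_problem] asks for some instance with the given code; injectivity makes it the very
    instance that the reduction built. *)
Lemma enc_instance_inj I I' : enc_instance I = enc_instance I' -> I = I'.
Proof.
  destruct I as [M h l q], I' as [M' h' l' q']; unfold enc_instance; simpl; intros H.
  apply enc_bprog_prefix in H; destruct H as [? H].
  apply enc_natlist_prefix in H; destruct H as [? H].
  apply enc_natlist_prefix in H; destruct H as [? H].
  destruct q as [a b], q' as [a' b']; unfold enc_Q in H; simpl in H.
  apply enc_Z_prefix in H; destruct H as [? H].
  rewrite <- (app_nil_r (enc_bits (pos_bits b))), <- (app_nil_r (enc_bits (pos_bits b'))) in H.
  apply enc_bits_prefix in H; destruct H as [H _]; apply pos_bits_inj in H; subst; auto.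
Qed.

Lemma enc_nat_pos p : enc_nat (Pos.to_nat p) = true :: enc_bits (pos_bits p).
Proof.
  pose proof (Pos2Nat.is_pos p). destruct (Pos.to_nat p) eqn:E; [lia|].
  cbn [enc_nat]. rewrite <- E, Pos2Nat.id. reflexivity.
Qed.

(** * Indicators and entropies of one uniform bit *)

Lemma ind_true (P : Prop) : P -> ind P = 1%R.
Proof. intros H; unfold ind; destruct excluded_middle_informative; tauto. Qed.

Lemma ind_false (P : Prop) : ~ P -> ind P = 0%R.
Proof. intros H; unfold ind; destruct excluded_middle_informative; tauto. Qed.

Lemma ent_0 : ent 0 = 0%R.
Proof. unfold ent; destruct Req_dec_T; [reflexivity|lra]. Qed.

Lemma ent_1 : ent 1 = 0%R.
Proof.
  unfold ent; destruct Req_dec_T; [reflexivity|].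
  unfold log2; rewrite Rinv_1, ln_1; lra.
Qed.

Lemma ent_half : ent (/ 2) = (/ 2)%R.
Proof.
  unfold ent; destruct Req_dec_T; [lra|].
  unfold log2; rewrite Rinv_inv. pose proof ln_lt_2. field. lra.
Qed.

Section OneHighBit.
Variable I : instance.
Hypothesis one : length (i_high I) = 1.

Let o0 := output I [false].
Let o1 := output I [true].

Lemma inputs_one : inputs I = [[false]; [true]].
Proof. unfold inputs; rewrite one; reflexivity. Qed.

Lemma muU_one h : muU I h = (/ 2)%R.
Proof. unfold muU; rewrite one; f_equal; ring. Qed.

Lemma obs_match_refl o : obs_match o o.
Proof. intros i; auto. Qed.

Lemma SE_equal_outputs : o0 = o1 -> SE I = 0%R.
Proof.
  intros E. unfold SE, entropy_H, entropy_H_given_O, muH_given_O, muO.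
  rewrite inputs_one; cbn [sumR fold_right]. rewrite !muU_one.
  fold o0 o1. rewrite <- !E.
  rewrite (ind_true (obs_match _ _)) by apply obs_match_refl.
  rewrite (ind_true (o0 = o0)) by reflexivity.
  replace (1 * / 2 / (1 * / 2 + (1 * / 2 + 0)))%R with (/ 2)%R by field.
  rewrite ent_half. field.
Qed.

(** Outputs match wherever one of them has ended, so they have to differ at an index that both
    reach. Then each observation determines the secret, and both posteriors are point masses. *)
Lemma SE_distinct_outputs i : o0 i <> None -> o1 i <> None -> o0 i <> o1 i -> SE I = 1%R.
Proof.
  intros N0 N1 D. unfold SE, entropy_H, entropy_H_given_O, muH_given_O, muO.
  rewrite inputs_one; cbn [sumR fold_right]. rewrite !muU_one.
  fold o0 o1.
  assert (D01 : o0 <> o1) by (intros E; apply D; rewrite E; reflexivity).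
  rewrite (ind_true (obs_match o0 o0)), (ind_true (obs_match o1 o1)) by apply obs_match_refl.
  rewrite (ind_true (o0 = o0)), (ind_true (o1 = o1)) by reflexivity.
  rewrite (ind_false (o1 = o0)), (ind_false (o0 = o1)) by (auto || (intros E; auto)).
  rewrite (ind_false (obs_match o0 o1)) by (intros H; destruct (H i) as [?|[?|?]]; congruence).
  rewrite (ind_false (obs_match o1 o0)) by (intros H; destruct (H i) as [?|[?|?]]; congruence).
  replace (1 * / 2 / (1 * / 2 + (0 * / 2 + 0)))%R with 1%R by field.
  replace (0 * / 2 / (1 * / 2 + (0 * / 2 + 0)))%R with 0%R by field.
  replace (1 * / 2 / (0 * / 2 + (1 * / 2 + 0)))%R with 1%R by field.
  replace (0 * / 2 / (0 * / 2 + (1 * / 2 + 0)))%R with 0%R by field.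
  rewrite ent_0, ent_1, ent_half. field.
Qed.
End OneHighBit.

(** * Execution of boolean programs *)

Definition reaches (M : bprog) (s : state) (M' : bprog) (s' : state) : Prop :=
  exists n, run M s n = Some (M', s').

Definition evals (M : bprog) (s s' : state) : Prop := reaches M s PSkip s'.

Lemma run_add M s n k :
  run M s (n + k) = match run M s n with Some (M', s') => run M' s' k | None => None end.
Proof.
  induction k as [|k IH].
  - rewrite Nat.add_0_r. destruct (run M s n) as [[M' s']|]; reflexivity.
  - rewrite Nat.add_succ_r; simpl; rewrite IH.
    destruct (run M s n) as [[M' s']|]; reflexivity.
Qed.

Lemma reaches_refl M s : reaches M s M s.
Proof. exists 0; reflexivity. Qed.

Lemma reaches_trans M s M' s' M'' s'' :
  reaches M s M' s' -> reaches M' s' M'' s'' -> reaches M s M'' s''.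
Proof. intros [n Hn] [k Hk]; exists (n + k); rewrite run_add, Hn; exact Hk. Qed.

Lemma reaches_step M s M' s' M'' s'' :
  step M s = Some (M', s') -> reaches M' s' M'' s'' -> reaches M s M'' s''.
Proof. intros H; apply reaches_trans; exists 1; exact H. Qed.

Lemma step_seq_unfold M0 M1 s : M0 <> PSkip ->
  step (PSeq M0 M1) s =
    match step M0 s with Some (M', s') => Some (PSeq M' M1, s') | None => None end.
Proof. destruct M0; congruence || reflexivity. Qed.

Lemma step_seq M0 s M' s' M1 :
  step M0 s = Some (M', s') -> step (PSeq M0 M1) s = Some (PSeq M' M1, s').
Proof. intros H. rewrite step_seq_unfold, H; [reflexivity|intros ->; discriminate]. Qed.

Lemma run_seq M0 M1 s n M' s' :
  run M0 s n = Some (M', s') -> run (PSeq M0 M1) s n = Some (PSeq M' M1, s').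
Proof.
  revert M' s'; induction n as [|n IH]; intros M' s' H; simpl in *.
  - inversion H; reflexivity.
  - destruct (run M0 s n) as [[M2 s2]|]; [|discriminate].
    rewrite (IH M2 s2 eq_refl). apply step_seq, H.
Qed.

Lemma evals_skip s : evals PSkip s s.
Proof. apply reaches_refl. Qed.

Lemma evals_seq M0 M1 s s' s'' :
  evals M0 s s' -> evals M1 s' s'' -> evals (PSeq M0 M1) s s''.
Proof.
  intros [n Hn] H1. apply reaches_trans with (PSeq PSkip M1) s'.
  - exists n; apply run_seq, Hn.
  - eapply reaches_step; [reflexivity|exact H1].
Qed.

Lemma evals_while_false e M s : beval e s = false -> evals (PWhile e M) s s.
Proof.
  intros H. eapply reaches_step; [reflexivity|].
  eapply reaches_step; [simpl; rewrite H; reflexivity|apply evals_skip].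
Qed.

Lemma evals_while_true e M s s' s'' :
  beval e s = true -> evals M s s' -> evals (PWhile e M) s' s'' -> evals (PWhile e M) s s''.
Proof.
  intros H H1 H2. eapply reaches_step; [reflexivity|].
  eapply reaches_step; [simpl; rewrite H; reflexivity|].
  eapply evals_seq; eassumption.
Qed.

Fixpoint loop_free (M : bprog) : Prop :=
  match M with
  | PSeq M0 M1 | PIf _ M0 M1 => loop_free M0 /\ loop_free M1
  | PWhile _ _ => False
  | _ => True
  end.

Fixpoint exec (M : bprog) (s : state) : state :=
  match M with
  | PAssign x e => upd s x (beval e s)
  | PSeq M0 M1 => exec M1 (exec M0 s)
  | PIf e M0 M1 => if beval e s then exec M0 s else exec M1 s
  | PWhile _ _ | PSkip => s
  end.

Lemma evals_exec M s : loop_free M -> evals M s (exec M s).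
Proof.
  revert s; induction M as [x e|M0 IH0 M1 IH1|e M0 IH0 M1 IH1|e M0 IH0|]; intros s L; simpl in *.
  - exists 1; reflexivity.
  - destruct L; eapply evals_seq; auto.
  - destruct L. eapply reaches_step; [reflexivity|]. destruct (beval e s); auto; [apply IH0|apply IH1]; auto.
  - contradiction.
  - apply evals_skip.
Qed.

(** * Lockstep runs of a program that does not mention a variable *)

Section Noninterference.
Variable x : nat.

Fixpoint fresh_expr (e : bexpr) : Prop :=
  match e with
  | BTrue => True
  | BVar y => y <> x
  | BAnd a b => fresh_expr a /\ fresh_expr b
  | BNot a => fresh_expr a
  end.

Fixpoint fresh (M : bprog) : Prop :=
  match M with
  | PAssign y e => y <> x /\ fresh_expr e
  | PSeq M0 M1 => fresh M0 /\ fresh M1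
  | PIf e M0 M1 => fresh_expr e /\ fresh M0 /\ fresh M1
  | PWhile e M0 => fresh_expr e /\ fresh M0
  | PSkip => True
  end.

Definition agree (s t : state) : Prop := forall y, y <> x -> s y = t y.

Lemma beval_agree e s t : fresh_expr e -> agree s t -> beval e s = beval e t.
Proof.
  induction e as [|y|a IHa b IHb|a IHa]; simpl; intros F A; auto.
  - destruct F; rewrite IHa, IHb; auto.
  - rewrite IHa; auto.
Qed.

(** Guards avoid [x], so both runs take the same branches and their remaining programs stay
    literally equal; in particular they end together. That [x] keeps its value lets the secret
    survive until it is leaked. *)
Lemma step_agree M s t : fresh M -> agree s t ->
  (step M s = None /\ step M t = None) \/
  exists M' s' t', step M s = Some (M', s') /\ step M t = Some (M', t') /\
    fresh M' /\ agree s' t' /\ s' x = s x /\ t' x = t x.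
Proof.
  induction M as [y e|M0 IH0 M1 IH1|e M0 IH0 M1 IH1|e M0 IH0|]; intros F A; simpl in F.
  - right. exists PSkip, (upd s y (beval e s)), (upd t y (beval e t)). destruct F as [F Fe].
    repeat split; auto.
    + intros z Hz. unfold upd. rewrite (beval_agree _ _ _ Fe A). destruct (z =? y); auto.
    + unfold upd. rewrite (proj2 (Nat.eqb_neq x y)); auto.
    + unfold upd. rewrite (proj2 (Nat.eqb_neq x y)); auto.
  - destruct F as [F0 F1]. destruct (IH0 F0 A) as [[E1 E2]|(M' & s' & t' & E1 & E2 & F' & A' & P)].
    + assert (D : M0 = PSkip \/ M0 <> PSkip) by (destruct M0; auto; right; discriminate).
      destruct D as [->|D]; [right; exists M1, s, t; simpl; auto 10|].
      left; rewrite !step_seq_unfold, E1, E2; auto.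
    + right; exists (PSeq M' M1), s', t'. rewrite (step_seq _ _ _ _ M1 E1), (step_seq _ _ _ _ M1 E2).
      simpl; auto 10.
  - right. destruct F as (Fe & F0 & F1). simpl. rewrite (beval_agree _ _ _ Fe A).
    exists (if beval e t then M0 else M1), s, t. destruct (beval e t); auto 10.
  - right. destruct F as (Fe & F0). simpl. eexists _, s, t. split; [reflexivity|]. simpl; auto 10.
  - left; auto.
Qed.

Lemma run_agree M s t n : fresh M -> agree s t ->
  (run M s n = None /\ run M t n = None) \/
  exists M' s' t', run M s n = Some (M', s') /\ run M t n = Some (M', t') /\
    fresh M' /\ agree s' t' /\ s' x = s x /\ t' x = t x.
Proof.
  intros F A; induction n as [|n IH]; simpl.
  - right; exists M, s, t; auto 10.
  - destruct IH as [[E1 E2]|(M' & s' & t' & E1 & E2 & F' & A' & P1 & P2)]; rewrite E1, E2; auto.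
    destruct (step_agree M' s' t' F' A') as [?|(M2 & s2 & t2 & E3 & E4 & F2 & A2 & P3 & P4)]; auto.
    right; exists M2, s2, t2; repeat split; auto; congruence.
Qed.
End Noninterference.

Definition leak (Main : bprog) (a h o : nat) : bprog :=
  PSeq Main (PIf (BVar a) (PAssign o (BVar h)) PSkip).

Lemma run_skip s n : run PSkip s (S n) = None.
Proof. induction n as [|n IH]; [reflexivity|]. cbn [run] in *. rewrite IH; reflexivity. Qed.

Section Leak.
Variables (Main : bprog) (a h o : nat) (q : Q).
Hypotheses (fresh_h : fresh h Main) (ah : a <> h) (oh : o <> h).

Let I := mkInstance (leak Main a h o) [h] [o] q.
Let s0 (b : bool) := init_state [h] [b].

Lemma init_agree : agree h (s0 false) (s0 true).
Proof. intros y Hy. unfold s0; simpl. rewrite (proj2 (Nat.eqb_neq y h) Hy). reflexivity. Qed.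

Lemma init_high b : s0 b h = b.
Proof. unfold s0; simpl. rewrite Nat.eqb_refl. reflexivity. Qed.

(** During [Main] the two runs differ only in [h], which is neither observed nor tested. Since [a]
    is not [h], they also agree on the final test, which alone decides whether the secret is
    shown. *)
Lemma SE_leak s' : evals Main (s0 false) s' -> SE I = if s' a then 1%R else 0%R.
Proof.
  intros [n Hn].
  assert (One : length (i_high I) = 1) by reflexivity.
  destruct (run_agree h Main (s0 false) (s0 true) n fresh_h init_agree)
    as [[E _]|(M' & s1 & t1 & E1 & E2 & _ & A & P1 & P2)]; [congruence|].
  rewrite E1 in Hn; inversion Hn; subst M' s1. clear Hn.
  rewrite init_high in P1, P2.
  set (fin := PIf (BVar a) (PAssign o (BVar h)) PSkip).
  (* The successor in [S k] is the step from [PSeq PSkip fin] to [fin]. *)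
  assert (After : forall b t, run Main (s0 b) n = Some (PSkip, t) ->
            forall k, run (leak Main a h o) (s0 b) (n + S k) = run fin t k).
  { intros b t E k. unfold leak; fold fin. rewrite run_add, (run_seq _ fin _ _ _ _ E).
    change (S k) with (1 + k). rewrite run_add. reflexivity. }
  destruct (s' a) eqn:Ea.
  (* [n + 3]: the run of [Main], one step that drops its [PSkip], one for the test and one for the
     assignment. The state is still visible at that index. *)
  - assert (Out : forall b t, t a = true -> t h = b -> run Main (s0 b) n = Some (PSkip, t) ->
              output I [b] (n + 3) = Some [b]).
    { intros b t Ta Th E. unfold output. cbn [i_prog i_high I]. fold (s0 b).
      rewrite (After b t E). unfold fin. simpl. rewrite Ta. simpl.
      unfold upd. rewrite Nat.eqb_refl, Th. reflexivity. }
    assert (Ta : t1 a = true) by (rewrite <- (A a ah); exact Ea).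
    apply (SE_distinct_outputs I One (n + 3));
      rewrite ?(Out false s' Ea P1 E1), ?(Out true t1 Ta P2 E2); congruence.
  - assert (Ta : t1 a = false) by (rewrite <- (A a ah); exact Ea).
    apply (SE_equal_outputs I One). apply functional_extensionality; intros i.
    unfold output. cbn [i_prog i_high i_low I]. fold (s0 false) (s0 true).
    destruct (le_lt_dec i n) as [Hi|Hi].
    + destruct (run_agree h Main (s0 false) (s0 true) i fresh_h init_agree)
        as [[E _]|(M' & s2 & t2 & E3 & E4 & _ & A2 & _)].
      * exfalso. replace n with (i + (n - i)) in E1 by lia. rewrite run_add, E in E1. discriminate.
      * unfold leak. rewrite (run_seq _ _ _ _ _ _ E3), (run_seq _ _ _ _ _ _ E4).
        simpl. rewrite (A2 o oh). reflexivity.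
    + replace i with (n + S (i - S n)) by lia.
      rewrite (After false s' E1), (After true t1 E2).
      (* The cases are [fin] itself, [PSkip] after its test, and bottom from then on. *)
      destruct (i - S n) as [|[|[|k]]].
      * simpl. rewrite (A o oh). reflexivity.
      * unfold fin; simpl. rewrite (A o oh). reflexivity.
      * unfold fin; simpl. rewrite Ea, Ta. reflexivity.
      * assert (forall t, t a = false -> run fin t (S (S (S k))) = None) as Z.
        { intros t Ht. change (S (S (S k))) with (1 + S (S k)). rewrite run_add.
          simpl run at 1. unfold fin; simpl step. rewrite Ht.
          apply run_skip. }
        rewrite (Z s' Ea), (Z t1 Ta). reflexivity.
Qed.
End Leak.

(** * Rotating a circular tape *)

(* [Ring i b] is bit [b] of the cell at distance [i] to the right of the head
   on a circular tape; [Cst] are the control variables. *)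
Inductive var : Type := Ring (i : nat) (b : bool) | Cst (k : nat).

(* Unary names: the template machine can extend them, but not count in binary. *)
Definition name (v : var) : list bool :=
  match v with
  | Ring i b => repeat true (S i) ++ [false; b]
  | Cst k => false :: repeat true k
  end.

(** [pos_bits] omits the leading one of the numeral, so every bit string, even with zeros in front,
    belongs to some positive. This inverse turns arbitrary words into variable names. *)
Definition bits_pos (l : list bool) : positive :=
  fold_left (fun p b => if b : bool then xI p else xO p) l xH.

Lemma pos_bits_bits_pos l : pos_bits (bits_pos l) = l.
Proof.
  induction l as [|b l IH] using rev_ind; [reflexivity|].
  unfold bits_pos in *; rewrite fold_left_app; simpl.
  destruct b; simpl; rewrite IH; reflexivity.
Qed.

Definition vn (v : var) : nat := Pos.to_nat (bits_pos (name v)).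

(** The number is exponential in the length of the name, but only its binary code is ever written,
    and that spells the name letter by letter. *)
Lemma enc_vn v : enc_nat (vn v) = true :: enc_bits (name v).
Proof. unfold vn. rewrite enc_nat_pos, pos_bits_bits_pos. reflexivity. Qed.

Lemma repeat_true_app_false_inj i i' l l' :
  repeat true i ++ false :: l = repeat true i' ++ false :: l' -> i = i' /\ l = l'.
Proof.
  revert i'; induction i as [|i IH]; intros [|i'] H; simpl in H; inversion H; auto.
  destruct (IH _ H1); auto.
Qed.

Lemma name_inj v w : name v = name w -> v = w.
Proof.
  destruct v as [i b|k], w as [i' b'|k']; simpl; intros H; inversion H.
  - apply repeat_true_app_false_inj in H1. destruct H1 as [-> H1]. inversion H1; reflexivity.
  - apply (f_equal (@length bool)) in H1. rewrite !repeat_length in H1. subst; reflexivity.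
Qed.

Lemma vn_inj v w : vn v = vn w -> v = w.
Proof.
  intros H. apply Pos2Nat.inj in H. apply name_inj.
  rewrite <- (pos_bits_bits_pos (name v)), H. apply pos_bits_bits_pos.
Qed.

Lemma vn_neq v w : v <> w -> vn v <> vn w.
Proof. intros H E; apply H, vn_inj, E. Qed.

Definition var_eqb (v w : var) : bool :=
  match v, w with
  | Ring i b, Ring i' b' => (i =? i') && eqb b b'
  | Cst k, Cst k' => k =? k'
  | _, _ => false
  end.

Lemma var_eqb_spec v w : reflect (v = w) (var_eqb v w).
Proof.
  destruct v as [i b|k], w as [i' b'|k']; simpl; try (constructor; congruence).
  - destruct (Nat.eqb_spec i i'), (eqb_spec b b'); constructor; congruence.
  - destruct (Nat.eqb_spec k k'); constructor; congruence.
Qed.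

Lemma upd_vn s v x w : upd s (vn v) x (vn w) = if var_eqb w v then x else s (vn w).
Proof.
  unfold upd. destruct (var_eqb_spec w v) as [->|H]; [rewrite Nat.eqb_refl; reflexivity|].
  rewrite (proj2 (Nat.eqb_neq _ _)); auto using vn_neq.
Qed.

(** Bit [false] says that the cell is not blank, bit [true] holds its value. Variables start as
    false, so a cell that was never loaded is blank. *)
Definition bitof (a : sym) (b : bool) : bool :=
  match a with Blank => false | S0 => negb b | S1 => true end.

Lemma bitof_inj a a' : bitof a false = bitof a' false -> bitof a true = bitof a' true -> a = a'.
Proof. destruct a, a'; simpl; congruence. Qed.

(** [Cst 0] and [Cst 1] are kept for the secret and the public variable. Next come the flags for a
    right move, a left move and loading, the two carry bits, a scratch variable, and one variable
    per machine state. *)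
Definition vRt := Cst 2.
Definition vLf := Cst 3.
Definition vLd := Cst 4.
Definition vC (b : bool) := if b then Cst 6 else Cst 5.
Definition vT := Cst 7.
Definition vQ (q : nat) := Cst (8 + q).

(* In block templates, the variables 0, 1, 2, 3 stand for the bits of the
   current and of the next ring cell and 4 + k for the control variable k. *)
Definition template_var (j x : nat) : var :=
  match x with
  | 0 => Ring j false | 1 => Ring j true | 2 => Ring (S j) false | 3 => Ring (S j) true
  | S (S (S (S k))) => Cst k
  end.

Fixpoint ren_expr (f : nat -> nat) (e : bexpr) : bexpr :=
  match e with
  | BTrue => BTrue
  | BVar x => BVar (f x)
  | BAnd a b => BAnd (ren_expr f a) (ren_expr f b)
  | BNot a => BNot (ren_expr f a)
  end.

Fixpoint ren (f : nat -> nat) (M : bprog) : bprog :=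
  match M with
  | PAssign x e => PAssign (f x) (ren_expr f e)
  | PSeq M0 M1 => PSeq (ren f M0) (ren f M1)
  | PIf e M0 M1 => PIf (ren_expr f e) (ren f M0) (ren f M1)
  | PWhile e M0 => PWhile (ren_expr f e) (ren f M0)
  | PSkip => PSkip
  end.

Definition exchange (t x y : nat) : bprog :=
  PSeq (PAssign t (BVar x)) (PSeq (PAssign x (BVar y)) (PAssign y (BVar t))).

Definition const_expr (b : bool) : bexpr := if b then BTrue else BNot BTrue.

(* Run for j = 0, 1, ..., the exchanges of adjacent cells rotate the ring by
   one, and the exchanges with the carry [vC] rotate it the other way. *)
Definition block_template (y : option bool) : bprog :=
  PIf (BVar 6) (PSeq (exchange 11 0 2) (exchange 11 1 3))
    (PIf (BVar 7) (PSeq (exchange 11 9 2) (exchange 11 10 3))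
      (PIf (BVar 8)
        match y with
        | Some b => PSeq (PAssign 0 BTrue) (PAssign 1 (const_expr b))
        | None => PSkip
        end PSkip)).

(** In [block_template], 6, 7 and 8 become [vRt], [vLf] and [vLd], 9 and 10 the carry bits, and 11
    becomes [vT]. The option [y] is the input bit to load. *)
Definition block (j : nat) (y : option bool) : bprog :=
  ren (fun x => vn (template_var j x)) (block_template y).

Fixpoint pass_from (j : nat) (ys : list (option bool)) : bprog :=
  match ys with
  | [] => PSkip
  | y :: ys => PSeq (block j y) (pass_from (S j) ys)
  end.

Lemma beval_const_expr b s : beval (const_expr b) s = b.
Proof. destruct b; reflexivity. Qed.

Lemma ren_const_expr f b : ren_expr f (const_expr b) = const_expr b.
Proof. destruct b; reflexivity. Qed.

Ltac simp_upd :=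
  repeat (rewrite ?upd_vn, ?Nat.eqb_refl, ?eqb_reflx, ?beval_const_expr, ?ren_const_expr;
          cbn [var_eqb eqb andb Nat.eqb template_var vRt vLf vLd vC vT beval]).

Ltac case_eqb :=
  repeat match goal with
  | |- context [Nat.eqb ?a ?b] => destruct (Nat.eqb_spec a b); subst; try lia
  end; try reflexivity; try congruence.

Section Block.
Variables (j : nat) (y : option bool) (s : state).

Lemma exec_block_right v : s (vn vRt) = true -> v <> vT ->
  exec (block j y) s (vn v) =
  match v with
  | Ring i b => if i =? j then s (vn (Ring (S j) b))
                else if i =? S j then s (vn (Ring j b)) else s (vn v)
  | Cst _ => s (vn v)
  end.
Proof.
  unfold vRt, vT. intros Rt Hv. unfold block, block_template, exchange. cbn. rewrite Rt.
  cbn [exec beval]. simp_upd.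
  destruct v as [i [|]|k]; simp_upd; rewrite ?andb_false_r, ?andb_true_r; case_eqb.
Qed.

Lemma exec_block_left v : s (vn vRt) = false -> s (vn vLf) = true -> v <> vT ->
  exec (block j y) s (vn v) =
  match v with
  | Ring i b => if i =? S j then s (vn (vC b)) else s (vn v)
  | Cst k => if k =? 5 then s (vn (Ring (S j) false))
             else if k =? 6 then s (vn (Ring (S j) true)) else s (vn v)
  end.
Proof.
  unfold vRt, vLf, vT. intros Rt Lf Hv. unfold block, block_template, exchange. cbn. rewrite Rt.
  cbn [exec beval]. rewrite Lf. cbn [exec beval]. simp_upd.
  destruct v as [i [|]|k]; simp_upd; rewrite ?andb_false_r, ?andb_true_r; case_eqb.
Qed.

Lemma exec_block_load v : s (vn vRt) = false -> s (vn vLf) = false -> s (vn vLd) = true ->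
  exec (block j y) s (vn v) =
  match v with
  | Ring i b => if i =? j then match y with Some a => bitof (sym_of_bool a) b | None => s (vn v) end
                else s (vn v)
  | Cst _ => s (vn v)
  end.
Proof.
  unfold vRt, vLf, vLd. intros Rt Lf Ld. unfold block, block_template, exchange. cbn. rewrite Rt.
  cbn [exec beval]. rewrite Lf. cbn [exec beval]. rewrite Ld. cbn [exec beval].
  destruct y as [a|]; cbn [ren exec].
  - simp_upd.
    destruct v as [i [|]|k]; simp_upd; rewrite ?andb_false_r, ?andb_true_r; destruct a; case_eqb.
  - destruct v; case_eqb.
Qed.

Lemma exec_block_idle : s (vn vRt) = false -> s (vn vLf) = false -> s (vn vLd) = false ->
  exec (block j y) s = s.
Proof.
  unfold vRt, vLf, vLd. intros Rt Lf Ld. unfold block, block_template. cbn. rewrite Rt.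
  cbn [exec beval]. rewrite Lf. cbn [exec beval]. rewrite Ld. reflexivity.
Qed.
End Block.

Fixpoint seg (s : state) (j : nat) (l : list sym) : Prop :=
  match l with
  | [] => True
  | a :: l => (forall b, s (vn (Ring j b)) = bitof a b) /\ seg s (S j) l
  end.

Lemma seg_ext s s' j l : (forall i b, j <= i -> s' (vn (Ring i b)) = s (vn (Ring i b))) ->
  seg s j l -> seg s' j l.
Proof.
  revert j; induction l as [|a l IH]; simpl; intros j E H; auto. destruct H as [Ha H]. split.
  - intros b; rewrite E; auto.
  - apply IH; auto. intros; apply E; lia.
Qed.

(** Successive exchanges push the symbol of cell [j] past all others to the far end, and each of
    those moves one place down. A ring of m + 1 cells thus takes m blocks. *)
Lemma exec_pass_right ys : forall j s a l, s (vn vRt) = true ->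
  length l = length ys -> seg s j (a :: l) ->
  let s' := exec (pass_from j ys) s in
  seg s' j (l ++ [a]) /\
  (forall i b, i < j -> s' (vn (Ring i b)) = s (vn (Ring i b))) /\
  (forall k, Cst k <> vT -> s' (vn (Cst k)) = s (vn (Cst k))).
Proof.
  induction ys as [|y ys IH]; intros j s a l Rt L H; destruct l as [|c l]; try discriminate; simpl.
  - simpl in H; tauto.
  - destruct H as [Ha [Hc H]].
    pose proof (fun v => exec_block_right j y s v Rt) as E.
    set (s1 := exec (block j y) s) in *.
    assert (H1 : seg s1 (S j) (a :: l)).
    { split.
      - intros b. rewrite E by discriminate. rewrite (proj2 (Nat.eqb_neq (S j) j)) by lia.
        rewrite Nat.eqb_refl. apply Ha.
      - eapply seg_ext; [|exact H]. intros i b Hi. rewrite E by discriminate.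
        rewrite (proj2 (Nat.eqb_neq i j)), (proj2 (Nat.eqb_neq i (S j))) by lia. reflexivity. }
    assert (R1 : s1 (vn vRt) = true) by (rewrite E; [exact Rt|discriminate]).
    injection L as L.
    destruct (IH (S j) s1 a l R1 L H1) as (I1 & I2 & I3).
    split; [split; [|exact I1]|split].
    + intros b. rewrite I2 by lia. rewrite E by discriminate. rewrite Nat.eqb_refl. apply Hc.
    + intros i b Hi. rewrite I2 by lia. rewrite E by discriminate.
      rewrite (proj2 (Nat.eqb_neq i j)), (proj2 (Nat.eqb_neq i (S j))) by lia. reflexivity.
    + intros k Hk. rewrite I3 by exact Hk. apply (E (Cst k) Hk).
Qed.

(** Each block drops the carry into the next cell and picks up the old content. The last symbol [d]
    remains in the carry, since no block knows that it is the last one; [finish] brings it round to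
    cell 0. *)
Lemma exec_pass_left ys : forall j s c l l' d, s (vn vRt) = false -> s (vn vLf) = true ->
  length l = length ys -> (forall b, s (vn (vC b)) = bitof c b) -> seg s (S j) l ->
  c :: l = l' ++ [d] ->
  let s' := exec (pass_from j ys) s in
  seg s' (S j) l' /\ (forall b, s' (vn (vC b)) = bitof d b) /\
  (forall i b, i <= j -> s' (vn (Ring i b)) = s (vn (Ring i b))) /\
  (forall k, Cst k <> vT -> (forall b, Cst k <> vC b) -> s' (vn (Cst k)) = s (vn (Cst k))).
Proof.
  induction ys as [|y ys IH]; intros j s c l l' d Rt Lf L C H E; destruct l as [|a l]; try discriminate;
    cbn [pass_from exec].
  - apply (app_inj_tail []) in E. destruct E as [<- <-]. simpl; auto.
  - destruct l' as [|c' l'']; [destruct l; discriminate|]. inversion E; subst c'. clear E. rename H2 into E.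
    destruct H as [Ha H].
    pose proof (fun v => exec_block_left j y s v Rt Lf) as X.
    set (s1 := exec (block j y) s) in *.
    assert (R1 : s1 (vn vRt) = false) by (rewrite X; [exact Rt|discriminate]).
    assert (L1 : s1 (vn vLf) = true) by (rewrite X; [exact Lf|discriminate]).
    assert (C1 : forall b, s1 (vn (vC b)) = bitof a b).
    { intros b. rewrite X by (destruct b; discriminate). destruct b; simpl; apply Ha. }
    assert (H1 : seg s1 (S (S j)) l).
    { eapply seg_ext; [|exact H]. intros i b Hi. rewrite X by discriminate.
      rewrite (proj2 (Nat.eqb_neq i (S j))) by lia. reflexivity. }
    injection L as L.
    destruct (IH (S j) s1 a l l'' d R1 L1 L C1 H1 E) as (I1 & I2 & I3 & I4).
    split; [split; [|exact I1]|split; [exact I2|split]].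
    + intros b. rewrite I3 by lia. rewrite X by discriminate. rewrite Nat.eqb_refl. apply C.
    + intros i b Hi. rewrite I3 by lia. rewrite X by discriminate.
      rewrite (proj2 (Nat.eqb_neq i (S j))) by lia. reflexivity.
    + intros k Hk HC. rewrite I4 by assumption. rewrite X by exact Hk.
      pose proof (HC false) as N0. pose proof (HC true) as N1. unfold vC in N0, N1.
      case_eqb.
Qed.

Definition load_sym (y : option bool) : sym :=
  match y with Some a => sym_of_bool a | None => Blank end.

(** The ring has one cell more than there are blocks. That cell, like the padding, keeps its false
    bits and so is blank. *)
Lemma exec_pass_load ys : forall j s, s (vn vRt) = false -> s (vn vLf) = false -> s (vn vLd) = true ->
  (forall i b, j <= i -> s (vn (Ring i b)) = false) ->
  let s' := exec (pass_from j ys) s in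
  seg s' j (map load_sym ys ++ [Blank]) /\
  (forall i b, i < j -> s' (vn (Ring i b)) = s (vn (Ring i b))) /\
  (forall k, s' (vn (Cst k)) = s (vn (Cst k))).
Proof.
  induction ys as [|y ys IH]; intros j s Rt Lf Ld Z; cbn [pass_from exec map app].
  - simpl. repeat split; auto.
  - pose proof (fun v => exec_block_load j y s v Rt Lf Ld) as X.
    set (s1 := exec (block j y) s) in *.
    destruct (IH (S j) s1) as (I1 & I2 & I3); try (rewrite X; assumption).
    { intros i b Hi. rewrite X, (proj2 (Nat.eqb_neq i j)) by lia. apply Z; lia. }
    split; [split; [|exact I1]|split].
    + intros b. rewrite I2, X, Nat.eqb_refl by lia. destruct y; [reflexivity|]. apply Z; lia.
    + intros i b Hi. rewrite I2, X, (proj2 (Nat.eqb_neq i j)) by lia. reflexivity.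
    + intros k. rewrite I3, X. reflexivity.
Qed.

Lemma exec_pass_idle ys : forall j s, s (vn vRt) = false -> s (vn vLf) = false -> s (vn vLd) = false ->
  exec (pass_from j ys) s = s.
Proof.
  induction ys as [|y ys IH]; intros j s Rt Lf Ld; cbn [pass_from exec]; [reflexivity|].
  rewrite exec_block_idle by assumption. auto.
Qed.

(** * Simulation of a Turing machine *)

Lemma tm_run_S T c n : tm_run T c (S n) = tm_run T (tm_step T c) n.
Proof. induction n as [|n IH]; [reflexivity|]. simpl in *. rewrite IH. reflexivity. Qed.

Definition halting (T : TM) (q : nat) : bool := (q =? tm_accept T) || (q =? tm_reject T).

Lemma tm_run_halting T c n : halting T (c_state c) = true -> tm_run T c n = c.
Proof.
  intros H; induction n as [|n IH]; [reflexivity|]. simpl. rewrite IH.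
  unfold tm_step. unfold halting in H. rewrite H. reflexivity.
Qed.

Lemma halted_halting T c : halted T c <-> halting T (c_state c) = true.
Proof. unfold halted, halting. rewrite orb_true_iff, !Nat.eqb_eq. tauto. Qed.

Definition lit (v : var) (b : bool) : bexpr := if b then BVar (vn v) else BNot (BVar (vn v)).

Lemma beval_lit v b s : beval (lit v b) s = eqb b (s (vn v)).
Proof. destruct b; simpl; destruct (s (vn v)); reflexivity. Qed.

Lemma exec_seq M0 M1 s : exec (PSeq M0 M1) s = exec M1 (exec M0 s).
Proof. reflexivity. Qed.

Section Simulation.
Variable T : TM.

Definition set (v : var) (b : bool) : bprog := PAssign (vn v) (const_expr b).

Definition guard (p : nat * sym) : bexpr :=
  BAnd (BVar (vn (vQ (fst p))))
    (BAnd (lit (Ring 0 false) (bitof (snd p) false)) (lit (Ring 0 true) (bitof (snd p) true))).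

Definition is_DR (d : dir) : bool := match d with DR => true | _ => false end.
Definition is_DL (d : dir) : bool := match d with DL => true | _ => false end.

(** The old state is cleared before the new one is set, as the two may coincide. The written symbol
    also goes into the carry, from which a left pass starts. *)
Definition action (p : nat * sym) : bprog :=
  let '(q', a, d) := tm_delta T (fst p) (snd p) in
  PSeq (set (vQ (fst p)) false) (PSeq (set (vQ q') true)
  (PSeq (set (Ring 0 false) (bitof a false)) (PSeq (set (Ring 0 true) (bitof a true))
  (PSeq (set (vC false) (bitof a false)) (PSeq (set (vC true) (bitof a true))
  (PSeq (set vRt (is_DR d)) (set vLf (is_DL d)))))))).

(** Nested conditionals instead of a sequence: an action changes state and symbol, and must not
    trigger a later guard in the same round. *)
Definition dispatch (l : list (nat * sym)) : bprog :=
  fold_right (fun p M => PIf (guard p) (action p) M) PSkip l.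

(** The first round only loads the input and makes no transition. *)
Definition control : bprog :=
  PIf (BVar (vn vLd)) PSkip (dispatch (list_prod (seq 0 (tm_nstates T)) [Blank; S0; S1])).

Definition finish : bprog :=
  PSeq (set vLd false) (PSeq (set vRt false)
    (PIf (BVar (vn vLf))
      (PSeq (PAssign (vn (Ring 0 false)) (BVar (vn (vC false))))
      (PSeq (PAssign (vn (Ring 0 true)) (BVar (vn (vC true))))
            (set vLf false)))
      PSkip)).

Definition body (ys : list (option bool)) : bprog :=
  PSeq control (PSeq (pass_from 0 ys) finish).

Definition running : bexpr :=
  BAnd (BNot (BVar (vn (vQ (tm_accept T))))) (BNot (BVar (vn (vQ (tm_reject T))))).

(** Loading is a round of the loop and shares its pass with the rotations, so the code contains the
    sequence of blocks only once. *)
Definition simulator (ys : list (option bool)) : bprog :=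
  PSeq (set (vQ (tm_start T)) true) (PSeq (set vLd true) (PWhile running (body ys))).

Definition one_hot (s : state) (q : nat) : Prop := forall q', s (vn (vQ q')) = (q' =? q).

Definition flags (s : state) (ld rt lf : bool) : Prop :=
  s (vn vLd) = ld /\ s (vn vRt) = rt /\ s (vn vLf) = lf.

Lemma exec_set v b s w : exec (set v b) s (vn w) = if var_eqb w v then b else s (vn w).
Proof. unfold set; cbn [exec]. rewrite beval_const_expr. apply upd_vn. Qed.

Lemma beval_guard s q a q' a' : one_hot s q -> (forall b, s (vn (Ring 0 b)) = bitof a b) ->
  beval (guard (q', a')) s = true <-> (q', a') = (q, a).
Proof.
  intros O A. unfold guard. cbn [beval fst snd]. rewrite !beval_lit, !A, O.
  rewrite !andb_true_iff, Nat.eqb_eq, !eqb_true_iff. split.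
  - intros (-> & E0 & E1). rewrite (bitof_inj a' a); auto.
  - intros E; inversion E; auto.
Qed.

Lemma exec_dispatch s q a l : one_hot s q -> (forall b, s (vn (Ring 0 b)) = bitof a b) ->
  In (q, a) l -> exec (dispatch l) s = exec (action (q, a)) s.
Proof.
  intros O A; induction l as [|[q' a'] l IH]; intros Hin; [destruct Hin|].
  simpl dispatch. cbn [exec]. pose proof (beval_guard s q a q' a' O A) as G.
  destruct (beval (guard (q', a')) s).
  - rewrite (proj1 G eq_refl). reflexivity.
  - destruct Hin as [E|Hin]; [|auto]. apply G in E. discriminate.
Qed.

Lemma exec_control s q a q' a' d : q < tm_nstates T ->
  one_hot s q -> flags s false false false -> (forall b, s (vn (Ring 0 b)) = bitof a b) ->
  tm_delta T q a = (q', a', d) ->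
  let s' := exec control s in
  one_hot s' q' /\ flags s' false (is_DR d) (is_DL d) /\
  (forall b, s' (vn (Ring 0 b)) = bitof a' b) /\ (forall b, s' (vn (vC b)) = bitof a' b) /\
  (forall i b, 1 <= i -> s' (vn (Ring i b)) = s (vn (Ring i b))).
Proof.
  intros Hq O (Ld & Rt & Lf) A D. cbn zeta.
  unfold control. cbn [exec beval]. rewrite Ld.
  rewrite (exec_dispatch s q a); auto.
  2:{ apply in_prod; [apply in_seq; lia|destruct a; simpl; auto]. }
  unfold action. cbn [fst snd]. rewrite D, !exec_seq.
  unfold one_hot, flags, vQ, vC, vLd, vRt, vLf.
  repeat split.
  - intros p. rewrite !exec_set. cbn [var_eqb Nat.add Nat.eqb].
    pose proof (O p) as Op. unfold vQ in Op. cbn [Nat.add] in Op. rewrite Op. case_eqb.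
  - rewrite !exec_set. exact Ld.
  - rewrite !exec_set. reflexivity.
  - rewrite !exec_set. reflexivity.
  - intros [|]; rewrite !exec_set; reflexivity.
  - intros [|]; rewrite !exec_set; reflexivity.
  - intros i b Hi. rewrite !exec_set. cbn [var_eqb]. rewrite (proj2 (Nat.eqb_neq i 0)) by lia. reflexivity.
Qed.

Lemma exec_finish s lf : s (vn vLf) = lf ->
  let s' := exec finish s in
  flags s' false false false /\
  (forall q, s' (vn (vQ q)) = s (vn (vQ q))) /\
  (forall b, s' (vn (Ring 0 b)) = if lf then s (vn (vC b)) else s (vn (Ring 0 b))) /\
  (forall i b, 1 <= i -> s' (vn (Ring i b)) = s (vn (Ring i b))).
Proof.
  intros Lf. cbn zeta. unfold finish. rewrite !exec_seq. cbn [exec beval].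
  rewrite !exec_set. cbn [var_eqb vLf vRt vLd Nat.eqb]. fold vLf. rewrite Lf.
  destruct lf; unfold flags, vQ, vC, vLd, vRt, vLf; repeat split.
  - intros q. rewrite exec_set, !upd_vn, !exec_set. reflexivity.
  - intros [|]; rewrite exec_set, !upd_vn, !exec_set; reflexivity.
  - intros i b Hi. rewrite exec_set, !upd_vn, !exec_set. cbn [var_eqb].
    rewrite (proj2 (Nat.eqb_neq i 0)) by lia. reflexivity.
  - rewrite !exec_set. exact Lf.
  - intros q. rewrite !exec_set. reflexivity.
  - intros b. rewrite !exec_set. reflexivity.
  - intros i b _. rewrite !exec_set. reflexivity.
Qed.

(* The circular tape is the tape of [c], cut open inside its blank part. *)
Definition simulates (m : nat) (s : state) (c : config) : Prop :=
  one_hot s (c_state c) /\ flags s false false false /\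
  exists k, S (length (c_right c) + k + length (c_left c)) = m /\
    seg s 0 (c_cur c :: c_right c ++ repeat Blank k ++ rev (c_left c)).

(** When the machine leaves its visited tape on either side, the ring supplies a blank from around
    the cut. The space bound on the next configuration ensures that one is left. *)
Lemma simulates_step ys s c :
  simulates (S (length ys)) s c -> c_state c < tm_nstates T -> halting T (c_state c) = false ->
  space (tm_step T c) <= S (length ys) ->
  simulates (S (length ys)) (exec (body ys) s) (tm_step T c).
Proof.
  destruct c as [q l a r]. unfold simulates, space, tm_step, halting; cbn [c_state c_left c_cur c_right].
  intros (O & F & k & L & A & H) Hq NH. rewrite NH. injection L as L.
  destruct (tm_delta T q a) as [[q' a'] d] eqn:D.
  unfold body. rewrite !exec_seq.
  destruct (exec_control s q a q' a' d Hq O F A D) as (O1 & (Ld1 & Rt1 & Lf1) & A1 & C1 & R1).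
  set (s1 := exec control s) in *.
  assert (H1 : seg s1 1 (r ++ repeat Blank k ++ rev l)).
  { eapply seg_ext; [|exact H]. exact R1. }
  set (rest := r ++ repeat Blank k ++ rev l) in *.
  assert (Lrest : length rest = length ys).
  { unfold rest. rewrite !length_app, repeat_length, length_rev. lia. }
  destruct d; cbn [is_DR is_DL] in *; intros Sp.
  (* Around the ring, the left neighbour [b] of the head is the last cell: the nearest symbol of
     [l], or a blank at the cut. *)
  - assert (X : exists k' b l', a' :: rest = (a' :: r ++ repeat Blank k' ++ rev l') ++ [b] /\
              S (length r) + k' + length l' = length ys /\
              match l with
              | [] => mkConfig q' [] Blank (a' :: r)
              | b :: l => mkConfig q' l b (a' :: r)
              end = mkConfig q' l' b (a' :: r)).
    { destruct l as [|b l]; cbn [c_left c_right length] in *.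
      (* With [k = 0] the tape would already fill the ring, and growing it would break the space
         bound. *)
      - destruct k as [|k]; [exfalso; lia|]. exists k, Blank, []. split; [|split; [simpl in *; lia|reflexivity]].
        unfold rest. simpl rev. rewrite !app_nil_r. cbn. rewrite <- app_assoc, <- repeat_cons.
        reflexivity.
      - exists k, b, l. split; [|split; [lia|reflexivity]].
        unfold rest. simpl. rewrite <- !app_assoc. reflexivity. }
    destruct X as (k' & b & l' & E & L' & ->). cbn [c_state c_left c_cur c_right].
    destruct (exec_pass_left ys 0 s1 a' rest _ b Rt1 Lf1 Lrest C1 H1 E) as (P1 & P2 & P3 & P4).
    set (s2 := exec (pass_from 0 ys) s1) in *.
    assert (Lf2 : s2 (vn vLf) = true) by (unfold vLf; rewrite P4; [exact Lf1|discriminate|intros []; discriminate]).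
    destruct (exec_finish s2 true Lf2) as (F3 & Q3 & Z3 & R3).
    split; [|split; [exact F3|]].
    + intros p. rewrite Q3. unfold vQ. rewrite P4; [apply O1|discriminate|intros []; discriminate].
    + exists k'. split; [simpl; lia|]. split.
      * intros b'. rewrite Z3. apply P2.
      * eapply seg_ext; [|exact P1]. intros; apply R3; lia.
  - assert (X : exists k' b r', rest = b :: r' ++ repeat Blank k' ++ rev l /\
              S (length r') + k' + length l = length ys /\
              match r with
              | [] => mkConfig q' (a' :: l) Blank []
              | b :: r => mkConfig q' (a' :: l) b r
              end = mkConfig q' (a' :: l) b r').
    { destruct r as [|b r]; cbn [c_left c_right length] in *.
      - destruct k as [|k]; [exfalso; lia|]. exists k, Blank, []. split; [reflexivity|split; [simpl in *; lia|reflexivity]].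
      - exists k, b, r. split; [reflexivity|split; [lia|reflexivity]]. }
    destruct X as (k' & b & r' & E & L' & ->). cbn [c_state c_left c_cur c_right].
    destruct (exec_pass_right ys 0 s1 a' rest Rt1 Lrest (conj A1 H1)) as (P1 & P2 & P3).
    set (s2 := exec (pass_from 0 ys) s1) in *.
    assert (Lf2 : s2 (vn vLf) = false) by (unfold vLf; rewrite P3; [exact Lf1|discriminate]).
    destruct (exec_finish s2 false Lf2) as (F3 & Q3 & Z3 & R3).
    split; [|split; [exact F3|]].
    + intros p. rewrite Q3. unfold vQ. rewrite P3; [apply O1|discriminate].
    + exists k'. split; [simpl; lia|].
      rewrite E in P1. apply seg_ext with s2.
      * intros [|i] b' _; [apply Z3|apply R3; lia].
      * simpl in P1 |- *. rewrite <- !app_assoc in P1. exact P1.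
  - cbn [c_state c_left c_cur c_right].
    rewrite (exec_pass_idle ys 0 s1) by assumption.
    destruct (exec_finish s1 false Lf1) as (F3 & Q3 & Z3 & R3).
    split; [|split; [exact F3|]].
    + intros p. rewrite Q3. apply O1.
    + exists k. split; [lia|]. apply seg_ext with s1.
      * intros [|i] b' _; [apply Z3|apply R3; lia].
      * split; assumption.
Qed.

Lemma beval_running s q : one_hot s q -> beval running s = negb (halting T q).
Proof.
  intros O. unfold running, halting. cbn [beval]. rewrite !O, negb_orb.
  rewrite (Nat.eqb_sym q), (Nat.eqb_sym q). reflexivity.
Qed.

Lemma loop_free_dispatch l : loop_free (dispatch l).
Proof.
  induction l as [|p l IH]; simpl; auto. split; auto.
  unfold action. destruct (tm_delta T (fst p) (snd p)) as [[? ?] ?]; simpl; auto 10.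
Qed.

Lemma loop_free_pass ys : forall j, loop_free (pass_from j ys).
Proof.
  induction ys as [|y ys IH]; intros j; simpl; auto. split; auto.
  destruct y; simpl; auto 10.
Qed.

Lemma loop_free_body ys : loop_free (body ys).
Proof. simpl. auto 10 using loop_free_dispatch, loop_free_pass. Qed.

Hypothesis wf : tm_wf T.

Lemma tm_step_state c : c_state c < tm_nstates T -> c_state (tm_step T c) < tm_nstates T.
Proof.
  intros H. unfold tm_step. destruct (_ || _); auto.
  destruct wf as (_ & _ & _ & W). specialize (W (c_state c) (c_cur c) H).
  destruct (tm_delta T (c_state c) (c_cur c)) as [[q' a] d]. simpl in W.
  destruct d; [destruct (c_left c)|destruct (c_right c)|]; exact W.
Qed.

Lemma evals_loop ys t : forall c s, simulates (S (length ys)) s c -> c_state c < tm_nstates T ->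
  (forall u, space (tm_run T c u) <= S (length ys)) -> halted T (tm_run T c t) ->
  exists s', evals (PWhile running (body ys)) s s' /\ one_hot s' (c_state (tm_run T c t)).
Proof.
  induction t as [|t IH]; intros c s Sim Hc Sp Ht;
    pose proof (beval_running s _ (proj1 Sim)) as B;
    destruct (halting T (c_state c)) eqn:E.
  - exists s. split; [apply evals_while_false; exact B|apply Sim].
  - apply halted_halting in Ht. simpl in Ht. congruence.
  - exists s. split; [apply evals_while_false; exact B|].
    rewrite tm_run_halting by exact E. apply Sim.
  - rewrite tm_run_S in Ht. destruct (IH (tm_step T c) (exec (body ys) s)) as (s' & E' & O'); auto.
    + apply simulates_step; auto. apply (Sp 1).
    + apply tm_step_state, Hc.
    + intros u. rewrite <- tm_run_S. apply Sp.
    + exists s'. rewrite tm_run_S. split; [|exact O'].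
      eapply evals_while_true; [exact B|apply evals_exec, loop_free_body|exact E'].
Qed.

Lemma simulates_init x r s : one_hot s (tm_start T) -> flags s true false false ->
  (forall i b, s (vn (Ring i b)) = false) ->
  let ys := map Some x ++ repeat None r in
  simulates (S (length ys)) (exec (body ys) s) (init_config T x).
Proof.
  intros O (Ld & Rt & Lf) Z. cbn zeta. set (ys := map Some x ++ repeat None r).
  unfold body, control. rewrite !exec_seq. cbn [exec beval]. rewrite Ld.
  destruct (exec_pass_load ys 0 s Rt Lf Ld (fun i b _ => Z i b)) as (P1 & _ & P3).
  set (s1 := exec (pass_from 0 ys) s) in *.
  assert (Lf1 : s1 (vn vLf) = false) by (unfold vLf; rewrite P3; exact Lf).
  destruct (exec_finish s1 false Lf1) as (F & Q & Z1 & R1).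
  assert (H : seg (exec finish s1) 0 (map sym_of_bool x ++ repeat Blank (S r))).
  { apply seg_ext with s1.
    - intros [|i] b _; [apply Z1|apply R1; lia].
    - replace (map sym_of_bool x ++ repeat Blank (S r)) with (map load_sym ys ++ [Blank]); [exact P1|].
      unfold ys. rewrite map_app, map_map, map_repeat, <- app_assoc, <- repeat_cons. reflexivity. }
  unfold init_config, simulates.
  assert (St : forall p, exec finish s1 (vn (vQ p)) = (p =? tm_start T)).
  { intros p. rewrite Q. unfold vQ. rewrite P3. apply O. }
  assert (Ly : length ys = length x + r).
  { unfold ys. rewrite length_app, length_map, repeat_length. reflexivity. }
  destruct x as [|a x]; cbn [map app c_state c_left c_cur c_right] in *.
  (* On an empty input the head itself occupies one of the [S r] blanks. *)
  - repeat split; try apply F; auto. exists r. rewrite Ly. split; [simpl; lia|].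
    simpl rev. rewrite app_nil_r. exact H.
  - repeat split; try apply F; auto. exists (S r). rewrite Ly. split; [simpl; rewrite length_map; lia|].
    simpl rev. rewrite app_nil_r. exact H.
Qed.

Lemma evals_simulator x r h t :
  let ys := map Some x ++ repeat None r in
  (forall u, space (tm_run T (init_config T x) u) <= S (length ys)) ->
  halted T (tm_run T (init_config T x) t) ->
  exists s', evals (simulator ys) (init_state [vn (Cst 0)] [h]) s' /\
             one_hot s' (c_state (tm_run T (init_config T x) t)).
Proof.
  cbn zeta. set (ys := map Some x ++ repeat None r). intros Sp Ht.
  set (s0 := init_state [vn (Cst 0)] [h]).
  assert (E0 : forall v, v <> Cst 0 -> s0 (vn v) = false).
  { intros v Hv. unfold s0; simpl. rewrite (proj2 (Nat.eqb_neq _ _)); auto using vn_neq. }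
  set (s1 := exec (set vLd true) (exec (set (vQ (tm_start T)) true) s0)).
  assert (O1 : one_hot s1 (tm_start T)).
  { intros p. unfold s1. rewrite !exec_set, E0 by discriminate. unfold vQ, vLd.
    cbn [var_eqb Nat.add Nat.eqb]. destruct (p =? tm_start T); reflexivity. }
  assert (F1 : flags s1 true false false).
  { unfold flags, s1. rewrite !exec_set, !E0 by discriminate. repeat split. }
  assert (Z1 : forall i b, s1 (vn (Ring i b)) = false).
  { intros i b. unfold s1. rewrite !exec_set, !E0 by discriminate. reflexivity. }
  assert (St : c_state (init_config T x) = tm_start T).
  { unfold init_config. destruct (map sym_of_bool x); reflexivity. }
  assert (W : exists s', evals (PWhile running (body ys)) s1 s' /\
             one_hot s' (c_state (tm_run T (init_config T x) t))).
  (* A start state that already halts skips the loop, and with it the loading. *)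
  { pose proof (beval_running s1 _ O1) as B. destruct (halting T (tm_start T)) eqn:E.
    - exists s1. rewrite tm_run_halting by (rewrite St; exact E). rewrite St.
      split; [apply evals_while_false, B|exact O1].
    - destruct (evals_loop ys t (init_config T x) (exec (body ys) s1)) as (s' & E' & O'); auto.
      + apply simulates_init; assumption.
      + rewrite St. apply wf.
      + exists s'. split; [|exact O'].
        eapply evals_while_true; [exact B|apply evals_exec, loop_free_body|exact E']. }
  destruct W as (s' & E' & O'). exists s'. split; [|exact O'].
  unfold simulator. eapply evals_seq; [apply evals_exec; exact Logic.I|].
  eapply evals_seq; [apply evals_exec; exact Logic.I|]. exact E'.
Qed.

Lemma fresh_set k v b : v <> Cst k -> fresh (vn (Cst k)) (set v b).
Proof. intros H. split; [apply vn_neq, H|destruct b; exact Logic.I]. Qed.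

Lemma fresh_lit k v b : v <> Cst k -> fresh_expr (vn (Cst k)) (lit v b).
Proof. intros H. destruct b; apply vn_neq, H. Qed.

Lemma fresh_simulator ys : fresh (vn (Cst 0)) (simulator ys).
Proof.
  assert (P : forall j, fresh (vn (Cst 0)) (pass_from j ys)).
  { induction ys as [|[[|]|] ys' IH]; intros j; cbn; auto;
      (split; [repeat split; apply vn_neq; discriminate|apply IH]). }
  assert (D : forall l, fresh (vn (Cst 0)) (dispatch l)).
  { induction l as [|p l IH]; cbn [dispatch fold_right fresh]; [exact Logic.I|]. split; [|split; [|exact IH]].
    - split; [apply vn_neq; discriminate|split; apply fresh_lit; discriminate].
    - unfold action. destruct (tm_delta T (fst p) (snd p)) as [[? ?] ?].
      repeat first [apply fresh_set; discriminate | apply conj]. }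
  unfold simulator. cbn [fresh]. repeat split; try apply P; try apply D;
    try (apply vn_neq; discriminate).
Qed.
End Simulation.

(** * Sweeping transducers as Turing machines *)

Definition poly (g : nat -> nat) : Prop := exists c k, forall n, g n <= poly_bound c k n.

Lemma poly_const a : poly (fun _ => a).
Proof. exists a, 0. intros n. unfold poly_bound. lia. Qed.

Lemma poly_id : poly (fun n => n).
Proof. exists 1, 1. intros n. unfold poly_bound. simpl. lia. Qed.

(** The summand 1 covers [n = 0] and [k = 0], where the left side is 0^0 = 1. *)
Lemma pow_le_pow_add n k l : n ^ k <= n ^ (k + l) + 1.
Proof.
  destruct n as [|n].
  - destruct k; simpl; [lia|]. lia.
  - pose proof (Nat.pow_le_mono_r (S n) k (k + l)). lia.
Qed.

Lemma poly_add g h : poly g -> poly h -> poly (fun n => g n + h n).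
Proof.
  intros (c & k & G) (c' & k' & H). exists (2 * c + 2 * c'), (k + k'). intros n.
  specialize (G n). specialize (H n). unfold poly_bound in *.
  pose proof (pow_le_pow_add n k k') as E. pose proof (pow_le_pow_add n k' k) as E'.
  rewrite (Nat.add_comm k' k) in E'. nia.
Qed.

Lemma poly_mul g h : poly g -> poly h -> poly (fun n => g n * h n).
Proof.
  intros (c & k & G) (c' & k' & H). exists (3 * (c * c')), (k + k'). intros n.
  specialize (G n). specialize (H n). unfold poly_bound in *.
  pose proof (pow_le_pow_add n k k') as E. pose proof (pow_le_pow_add n k' k) as E'.
  rewrite (Nat.add_comm k' k) in E'.
  transitivity ((c * n ^ k + c) * (c' * n ^ k' + c')); [apply Nat.mul_le_mono; assumption|].
  rewrite Nat.pow_add_r in *.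
  transitivity (c * c' * (n ^ k * n ^ k' + n ^ k + n ^ k' + 1)); [lia|].
  replace (3 * (c * c') * (n ^ k * n ^ k') + 3 * (c * c'))
    with (c * c' * (3 * (n ^ k * n ^ k') + 3)) by ring.
  apply Nat.mul_le_mono_l. lia.
Qed.

Lemma poly_pow g k : poly g -> poly (fun n => g n ^ k).
Proof.
  intros G. induction k as [|k IH]; simpl; [apply poly_const|]. apply poly_mul; assumption.
Qed.

(** Streams forget how many blanks at the end of a tape list have been visited, so tapes can be
    compared by plain equality. *)
Definition stream := nat -> sym.
Definition blanks : stream := fun _ => Blank.
Definition push (a : sym) (s : stream) : stream :=
  fun i => match i with O => a | S i => s i end.
Definition pop (s : stream) : stream := fun i => s (S i).
Definition app_bits (l : list bool) (s : stream) : stream :=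
  fold_right (fun b s => push (sym_of_bool b) s) s l.
Definition stream_of (l : list sym) : stream := fun i => nth i l Blank.

Lemma push_blanks : push Blank blanks = blanks.
Proof. apply functional_extensionality; intros []; reflexivity. Qed.

Lemma app_bits_app l l' s : app_bits (l ++ l') s = app_bits l (app_bits l' s).
Proof. apply fold_right_app. Qed.

Lemma app_bits_rev_cons b l s : app_bits (rev (b :: l)) s = app_bits (rev l) (push (sym_of_bool b) s).
Proof. simpl. rewrite app_bits_app. reflexivity. Qed.

Lemma stream_of_nil : stream_of [] = blanks.
Proof. apply functional_extensionality; intros []; reflexivity. Qed.

Lemma stream_of_cons a l : stream_of (a :: l) = push a (stream_of l).
Proof. apply functional_extensionality; intros []; reflexivity. Qed.

Lemma stream_of_bits l : stream_of (map sym_of_bool l) = app_bits l blanks.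
Proof.
  induction l as [|b l IH]; simpl; [apply stream_of_nil|]. rewrite stream_of_cons, IH. reflexivity.
Qed.

Lemma bits_until_blank_stream y : forall l, stream_of l = app_bits y blanks -> bits_until_blank l = y.
Proof.
  induction y as [|b y IH]; intros l H.
  - apply (f_equal (fun s => s 0)) in H. destruct l as [|[] l]; try reflexivity; discriminate.
  - destruct l as [|a l].
    + apply (f_equal (fun s => s 0)) in H. destruct b; discriminate.
    + rewrite stream_of_cons in H.
      pose proof (f_equal (fun s => s 0) H) as Ha. pose proof (f_equal pop H) as Hl.
      simpl in Ha. change (stream_of l = app_bits y blanks) in Hl. rewrite Ha.
      destruct b; simpl; f_equal; auto.
Qed.

(* A sweeping transducer rewrites a word from left to right, over and over
   again, until it reaches a state where [stop] holds at the end of a sweep. *)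
Section Sweep.
Variables (Q : Type) (eqQ : forall p q : Q, {p = q} + {p <> q}) (states : list Q).
Variables (trans : Q -> bool -> Q * list bool) (last : Q -> Q * list bool).
Variables (start : Q) (stop : Q -> bool) (width : nat).
Hypothesis start_ok : In start states.
Hypothesis trans_ok : forall q b, In q states ->
  In (fst (trans q b)) states /\ length (snd (trans q b)) <= width.
Hypothesis last_ok : forall q, In q states ->
  In (fst (last q)) states /\ length (snd (last q)) <= width.

Fixpoint sweep (q : Q) (l : list bool) : Q * list bool :=
  match l with
  | [] => last q
  | b :: l => let (q1, w) := trans q b in let (q2, y) := sweep q1 l in (q2, w ++ y)
  end.

Inductive sweeps (B : nat) : nat -> Q -> list bool -> Q -> list bool -> Prop :=
| sweeps_refl q y : sweeps B 0 q y q y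
| sweeps_step n q y q1 y1 q' y' : stop q = false -> length y <= B -> sweep q y = (q1, y1) ->
    length y1 <= B -> sweeps B n q1 y1 q' y' -> sweeps B (S n) q y q' y'.

(* During a sweep the tape holds the unread part of the word, a blank and the
   output so far: read and erase the first symbol, go past the blank to the end
   of the output, append, and come back.  The flag tells whether the word is
   used up. *)
Inductive ctl : Type :=
| Done
| Read (q : Q)
| ToSep (q : Q) (w : list bool)
| ToEnd (q : Q) (w : list bool) (e : bool)
| Put (q : Q) (w : list bool) (e : bool)
| BackSep (q : Q) (e : bool)
| BackStart (q : Q).

Definition enter (q : Q) : ctl := if stop q then Done else Read q.

Definition ctl_delta (c : ctl) (a : sym) : ctl * sym * dir :=
  match c with
  | Done => (Done, a, DN)
  | Read q =>
      match a with
      | Blank => let (q', w) := last q in (ToEnd q' w true, Blank, DR)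
      | S0 => let (q', w) := trans q false in (ToSep q' w, Blank, DR)
      | S1 => let (q', w) := trans q true in (ToSep q' w, Blank, DR)
      end
  | ToSep q w => (match a with Blank => ToEnd q w false | _ => ToSep q w end, a, DR)
  | ToEnd q w e => match a with Blank => (Put q w e, Blank, DN) | _ => (ToEnd q w e, a, DR) end
  | Put q [] e => (BackSep q e, Blank, DL)
  | Put q (b :: w) e => (Put q w e, sym_of_bool b, DR)
  | BackSep q e =>
      match a with
      | Blank => if e then (enter q, Blank, DR) else (BackStart q, Blank, DL)
      | _ => (BackSep q e, a, DL)
      end
  | BackStart q => match a with Blank => (Read q, Blank, DR) | _ => (BackStart q, a, DL) end
  end.

(* Control state, tape left of the head, tape from the head on. *)
Definition sconfig : Type := (ctl * stream * stream)%type.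

Definition sstep (c : sconfig) : sconfig :=
  let '(q, l, r) := c in
  let '(q', a, d) := ctl_delta q (r 0) in
  match d with
  | DN => (q', l, push a (pop r))
  | DR => (q', push a l, pop r)
  | DL => (q', pop l, push (l 0) (push a (pop r)))
  end.

Fixpoint srun (n : nat) (c : sconfig) : sconfig :=
  match n with O => c | S n => srun n (sstep c) end.

Lemma srun_add m n c : srun (m + n) c = srun n (srun m c).
Proof. revert c; induction m; simpl; auto. Qed.

Lemma srun_to_sep q w inp l r :
  srun (length inp + 1) (ToSep q w, l, app_bits inp (push Blank r)) =
  (ToEnd q w false, push Blank (app_bits (rev inp) l), r).
Proof.
  revert l; induction inp as [|b inp IH]; intros l; [reflexivity|].
  rewrite app_bits_rev_cons, <- IH. destruct b; reflexivity.
Qed.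

Lemma srun_to_end q w e out l :
  srun (length out + 1) (ToEnd q w e, l, app_bits out blanks) =
  (Put q w e, app_bits (rev out) l, blanks).
Proof.
  revert l; induction out as [|b out IH]; intros l.
  - simpl. change (pop blanks) with blanks. rewrite push_blanks. reflexivity.
  - rewrite app_bits_rev_cons, <- IH. destruct b; reflexivity.
Qed.

Lemma srun_put q e w l : let l' := app_bits (rev w) l in
  srun (length w + 1) (Put q w e, l, blanks) = (BackSep q e, pop l', push (l' 0) blanks).
Proof.
  cbn zeta. revert l; induction w as [|b w IH]; intros l.
  - simpl. change (pop blanks) with blanks. rewrite push_blanks. reflexivity.
  - rewrite app_bits_rev_cons, <- IH. reflexivity.
Qed.

(** Describing the head cell as the top of [l'] avoids a special case for empty output: the head
    then already stands on the separator. *)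
Lemma srun_back_sep q e out l r : let l' := app_bits (rev out) (push Blank l) in
  srun (length out) (BackSep q e, pop l', push (l' 0) r) =
  (BackSep q e, l, push Blank (app_bits out r)).
Proof.
  cbn zeta. revert r; induction out as [|b out IH] using rev_ind; intros r; [reflexivity|].
  rewrite rev_app_distr, length_app, Nat.add_comm, (app_bits_app out [b]), <- IH. destruct b; reflexivity.
Qed.

Lemma srun_back_start q inp r : let l' := app_bits (rev inp) blanks in
  srun (length inp + 1) (BackStart q, pop l', push (l' 0) r) = (Read q, blanks, app_bits inp r).
Proof.
  cbn zeta. revert r; induction inp as [|b inp IH] using rev_ind; intros r.
  - simpl. change (pop blanks) with blanks. rewrite push_blanks. reflexivity.
  - rewrite rev_app_distr, length_app, (Nat.add_comm (length inp)), (app_bits_app inp [b]), <- IH.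
    destruct b; reflexivity.
Qed.

Lemma srun_append q w e out l :
  srun (2 * (length out + length w) + 2) (ToEnd q w e, push Blank l, app_bits out blanks) =
  (BackSep q e, l, push Blank (app_bits (out ++ w) blanks)).
Proof.
  replace (2 * (length out + length w) + 2)
    with ((length out + 1) + ((length w + 1) + length (out ++ w))) by (rewrite length_app; lia).
  rewrite srun_add, srun_to_end, srun_add, srun_put, <- app_bits_app, <- rev_app_distr.
  apply srun_back_sep.
Qed.

Lemma srun_symbol q b inp out : let (q', w) := trans q b in
  srun (2 * (length inp + length out + length w) + 6)
    (Read q, blanks, app_bits (b :: inp) (push Blank (app_bits out blanks))) =
  (Read q', blanks, app_bits inp (push Blank (app_bits (out ++ w) blanks))).
Proof.
  destruct (trans q b) as [q' w] eqn:E.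
  replace (2 * (length inp + length out + length w) + 6)
    with (1 + ((length inp + 1) + ((2 * (length out + length w) + 2) + (1 + (length inp + 1))))) by lia.
  rewrite srun_add.
  replace (srun 1 _) with (ToSep q' w, blanks, app_bits inp (push Blank (app_bits out blanks)))
    by (rewrite <- push_blanks at 1; destruct b; simpl; rewrite E; reflexivity).
  rewrite srun_add, srun_to_sep, srun_add, srun_append, srun_add.
  apply srun_back_start.
Qed.

Lemma srun_last q out : let (q', w) := last q in
  srun (2 * (length out + length w) + 4) (Read q, blanks, push Blank (app_bits out blanks)) =
  (enter q', blanks, app_bits (out ++ w) blanks).
Proof.
  destruct (last q) as [q' w] eqn:E.
  replace (2 * (length out + length w) + 4)
    with (1 + ((2 * (length out + length w) + 2) + 1)) by lia.
  rewrite srun_add.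
  replace (srun 1 _) with (ToEnd q' w true, push Blank blanks, app_bits out blanks)
    by (simpl; rewrite E; reflexivity).
  rewrite srun_add, srun_append.
  cbn. change (fun i => app_bits (out ++ w) blanks i) with (app_bits (out ++ w) blanks).
  rewrite push_blanks. reflexivity.
Qed.

(** As symbols pass from the pending output [y] to [out], the sum of the two lengths is constant, so
    one bound serves all rounds. *)
Lemma srun_sweep_from l : forall q out q' y, sweep q l = (q', y) ->
  exists n, n <= (length l + 1) * (2 * (length l + length out + length y) + 6) /\
    srun n (Read q, blanks, app_bits l (push Blank (app_bits out blanks))) =
    (enter q', blanks, app_bits (out ++ y) blanks).
Proof.
  induction l as [|b l IH]; intros q out q' y H; simpl in H.
  - pose proof (srun_last q out) as L. rewrite H in L. eexists; split; [|exact L]. simpl; lia.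
  - pose proof (srun_symbol q b l out) as L. destruct (trans q b) as [q1 w].
    destruct (sweep q1 l) as [q2 y1] eqn:E. inversion H; subst q2 y; clear H.
    destruct (IH q1 (out ++ w) q' y1 E) as (n & Hn & R).
    exists (2 * (length l + length out + length w) + 6 + n). split.
    + rewrite length_app in *. simpl. nia.
    + rewrite srun_add, L, R, <- app_assoc. reflexivity.
Qed.

Lemma srun_sweeps B n q y q' y' : sweeps B n q y q' y' ->
  exists t, t <= n * ((B + 1) * (4 * B + 6)) /\
    srun t (enter q, blanks, app_bits y blanks) = (enter q', blanks, app_bits y' blanks).
Proof.
  induction 1 as [q y|n q y q1 y1 q' y' Hq Hy E Hy1 _ (t & Ht & R)].
  - exists 0; split; [lia|reflexivity].
  - destruct (srun_sweep_from y q [] q1 y1 E) as (t1 & Ht1 & R1).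
    exists (t1 + t). split.
    + enough (t1 <= (B + 1) * (4 * B + 6)) by (simpl; lia).
      etransitivity; [exact Ht1|]. apply Nat.mul_le_mono; simpl; lia.
    + rewrite srun_add. unfold enter at 1. rewrite Hq.
      (* Before any output, the separator is simply the blank that follows the word. *)
      simpl in R1. rewrite push_blanks in R1. rewrite R1. exact R.
Qed.

(** * Numbering the control states *)

Definition ctl_eq_dec (c c' : ctl) : {c = c'} + {c <> c'}.
Proof. decide equality; auto using bool_dec, list_eq_dec. Defined.

Definition words : list (list bool) := flat_map all_inputs (seq 0 (S width)).

Lemma in_all_inputs w : In w (all_inputs (length w)).
Proof.
  induction w as [|b w IH]; simpl; [auto|]. apply in_or_app.
  destruct b; [right|left]; apply in_map, IH.
Qed.

Lemma in_words w : length w <= width -> In w words.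
Proof.
  intros H. apply in_flat_map. exists (length w). split; [apply in_seq; lia|apply in_all_inputs].
Qed.

Definition ctls : list ctl :=
  Done :: flat_map (fun q => Read q :: BackStart q :: BackSep q true :: BackSep q false ::
    flat_map (fun w => [ToSep q w; ToEnd q w true; ToEnd q w false; Put q w true; Put q w false]) words)
    states.

Definition ctl_ok (c : ctl) : Prop :=
  match c with
  | Done => True
  | Read q | BackStart q | BackSep q _ => In q states
  | ToSep q w | ToEnd q w _ | Put q w _ => In q states /\ length w <= width
  end.

Lemma in_ctls c : ctl_ok c -> In c ctls.
Proof.
  intros H. unfold ctls. pose proof in_words as W. generalize dependent words. intros ws W. destruct c as [|q|q w|q w e|q w e|q e|q]; simpl in H;
    [left; reflexivity|right; apply in_flat_map; exists q; split; [tauto|] ..]; simpl; auto;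
    try (destruct e; simpl; tauto);
    do 4 right; apply in_flat_map; exists w; destruct H as [_ H]; apply W in H;
    split; auto; try destruct e; simpl; tauto.
Qed.

Lemma ctl_ok_delta c a : ctl_ok c -> ctl_ok (fst (fst (ctl_delta c a))).
Proof.
  destruct c as [|q|q w|q w e|q w e|q e|q]; simpl; intros H; auto.
  - destruct a.
    + pose proof (last_ok q H). destruct (last q); auto.
    + pose proof (trans_ok q false H). destruct (trans q false); auto.
    + pose proof (trans_ok q true H). destruct (trans q true); auto.
  - destruct a; auto.
  - destruct a; auto.
  - destruct w; simpl in *; [tauto|]. split; [tauto|lia].
  - destruct a; auto. destruct e; auto. unfold enter; simpl. destruct (stop q); simpl; auto.
  - destruct a; auto.
Qed.

Fixpoint index (c : ctl) (l : list ctl) : nat :=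
  match l with
  | [] => 0
  | c' :: l => if ctl_eq_dec c c' then 0 else S (index c l)
  end.

Lemma index_lt c l : In c l -> index c l < length l.
Proof.
  induction l as [|c' l IH]; [intros []|]. intros [->|H]; simpl; destruct ctl_eq_dec; try lia.
  - congruence.
  - apply IH in H; lia.
Qed.

Lemma nth_index c l : In c l -> nth (index c l) l Done = c.
Proof.
  induction l as [|c' l IH]; [intros []|]. intros H; simpl; destruct ctl_eq_dec; auto.
  destruct H; [congruence|auto].
Qed.

(** The value 0 outside the list makes every code a legal state, so well-formedness of the machine
    needs no invariant on its controls. *)
Definition code (c : ctl) : nat := if in_dec ctl_eq_dec c ctls then index c ctls else 0.

Definition sweep_TM : TM :=
  mkTM (length ctls)
    (fun n a => let '(c, a', d) := ctl_delta (nth n ctls Done) a in (code c, a', d))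
    (code (enter start)) (code Done) (code Done).

Lemma code_lt c : code c < length ctls.
Proof.
  unfold code. destruct in_dec as [H|H]; [apply index_lt, H|]. simpl; lia.
Qed.

Lemma nth_code c : ctl_ok c -> nth (code c) ctls Done = c.
Proof.
  intros H. unfold code. destruct in_dec as [I|I]; [apply nth_index, I|].
  destruct I; apply in_ctls, H.
Qed.

Lemma sweep_TM_wf : tm_wf sweep_TM.
Proof.
  repeat split; try apply code_lt. intros q a _. simpl.
  destruct (ctl_delta _ a) as [[c a'] d]. apply code_lt.
Qed.

Definition represents (c : config) (s : sconfig) : Prop :=
  let '(q, l, r) := s in
  c_state c = code q /\ stream_of (c_left c) = l /\ stream_of (c_cur c :: c_right c) = r /\ ctl_ok q.

Lemma represents_step c s : represents c s -> represents (tm_step sweep_TM c) (sstep s).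
Proof.
  destruct s as [[q l] r], c as [n l0 a r0]. unfold represents, tm_step; cbn [c_state c_left c_cur c_right].
  intros (-> & <- & <- & Ok). cbn [tm_accept tm_reject sweep_TM]. rewrite orb_diag.
  rewrite stream_of_cons. cbn [sstep push].
  pose proof (ctl_ok_delta q a Ok) as Ok'.
  change (pop (push a (stream_of r0))) with (stream_of r0).
  destruct (Nat.eqb_spec (code q) (code Done)) as [E|E].
  - apply (f_equal (fun n => nth n ctls Done)) in E. rewrite !nth_code in E by (auto; exact Logic.I).
    subst q. simpl. rewrite stream_of_cons. repeat split.
  - cbn [tm_delta sweep_TM]. rewrite nth_code by exact Ok.
    destruct (ctl_delta q a) as [[q' a'] d]. simpl in Ok'.
    destruct d; [destruct l0|destruct r0|]; cbn [c_state c_left c_cur c_right];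
      rewrite ?stream_of_cons, ?stream_of_nil; repeat split; auto.
    change (pop blanks) with blanks. apply push_blanks.
Qed.

Lemma represents_run c s n : represents c s -> represents (tm_run sweep_TM c n) (srun n s).
Proof.
  revert s; induction n as [|n IH]; intros s H; [exact H|].
  replace (S n) with (n + 1) by lia. rewrite srun_add, Nat.add_1_r. simpl.
  apply represents_step, IH, H.
Qed.

Lemma ctl_ok_enter q : In q states -> ctl_ok (enter q).
Proof. unfold enter; destruct (stop q); simpl; auto. Qed.

Lemma represents_init x : represents (init_config sweep_TM x) (enter start, blanks, app_bits x blanks).
Proof.
  unfold represents. rewrite <- stream_of_bits. unfold init_config.
  pose proof (ctl_ok_enter start start_ok) as Ok.
  destruct (map sym_of_bool x); cbn [c_state c_left c_cur c_right]; repeat split; auto using stream_of_nil.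
  rewrite stream_of_cons, stream_of_nil. apply push_blanks.
Qed.

Theorem sweeps_poly_time (f : list bool -> list bool) (N B : nat -> nat) :
  poly N -> poly B ->
  (forall x, exists n q, n <= N (length x) /\ stop q = true /\
     sweeps (B (length x)) n start x q (f x)) ->
  poly_time_computable f.
Proof.
  intros PN PB H.
  assert (PT : poly (fun n => N n * ((B n + 1) * (4 * B n + 6)))).
  { apply poly_mul; [exact PN|]. apply poly_mul; apply poly_add; try apply poly_const; [exact PB|].
    apply poly_mul; [apply poly_const|exact PB]. }
  destruct PT as (c & k & PT). exists sweep_TM, c, k. split; [apply sweep_TM_wf|].
  intros x. destruct (H x) as (n & q & Hn & Hq & Sw).
  destruct (srun_sweeps _ _ _ _ _ _ Sw) as (t & Ht & R).
  exists t. split.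
  - etransitivity; [exact Ht|]. etransitivity; [|apply PT]. apply Nat.mul_le_mono_r, Hn.
  - pose proof (represents_run _ _ t (represents_init x)) as Rep. rewrite R in Rep.
    unfold enter in Rep. rewrite Hq in Rep. destruct Rep as (E1 & _ & E2 & _).
    split; [left; exact E1|]. apply bits_until_blank_stream, E2.
Qed.
End Sweep.

(** * Generating the program *)

Lemma sweeps_trans Q trans last stop B n m (q q1 q2 : Q) y y1 y2 :
  sweeps Q trans last stop B n q y q1 y1 -> sweeps Q trans last stop B m q1 y1 q2 y2 ->
  sweeps Q trans last stop B (n + m) q y q2 y2.
Proof. induction 1; intros H'; simpl; [exact H'|]. eapply sweeps_step; eauto. Qed.

Lemma sweeps_one Q trans last (stop : Q -> bool) B q y q1 y1 :
  stop q = false -> sweep Q trans last q y = (q1, y1) -> length y <= B -> length y1 <= B ->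
  sweeps Q trans last stop B 1 q y q1 y1.
Proof. intros. eapply sweeps_step; eauto. apply sweeps_refl. Qed.

(* Work alphabet: [K b] is an output bit, [V] a slot, [U] a unary digit put
   into the slot before it, [H] a header and [G] a header already visited. *)
Inductive tsym : Type := K (b : bool) | V | U | H | G.

Definition KV (l : list tsym) : Prop := Forall (fun s => s <> H /\ s <> G /\ s <> U) l.

Definition code3 (s : tsym) : list bool :=
  match s with
  | K b => [false; false; b]
  | V => [false; true; false]
  | U => [false; true; true]
  | H => [true; false; false]
  | G => [true; false; true]
  end.

Definition decode3 (a b c : bool) : tsym :=
  match a, b with
  | false, false => K c
  | false, true => if c then U else V
  | true, _ => if c then G else H
  end.

Definition codes (l : list tsym) : list bool := flat_map code3 l.

Lemma codes_app l l' : codes (l ++ l') = codes l ++ codes l'.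
Proof. apply flat_map_app. Qed.

Lemma length_codes l : length (codes l) = 3 * length l.
Proof. induction l as [|s l IH]; [reflexivity|]. simpl; rewrite length_app, IH. destruct s; simpl; lia. Qed.

(* [Loop] visits one header per sweep and adds a digit to every later slot, so
   that the slots behind d headers finally hold d in unary. *)
Inductive mode : Type := Raw | Loop (i : nat) (visited : bool) | Reset (i : nat) | Expand | Out0 | Out1 | Halt.

Section Transducer.
Variables (tpl : option bool -> list tsym) (pre post : list bool) (r0 k : nat).
Hypothesis tpl_KV : forall y, KV (tpl y).

(** Digits become slots themselves: [r] slots with n digits each turn into r (n + 1) slots, and the
    headers can be visited again. *)
Definition reset (s : tsym) : tsym := match s with G => H | U => V | _ => s end.

(** Each input bit becomes a loading block, each slot or digit of the padding a block that loads
    nothing. The fresh headers serve to number the blocks. *)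
Definition expand (s : tsym) : list tsym :=
  match s with
  | K b => H :: tpl (Some b)
  | V | U => H :: tpl None
  | H | G => []
  end.

(** A digit is one [true] in a name, which [enc_bits] writes as two bits. *)
Definition out (s : tsym) : list bool :=
  match s with K b => [b] | U => [true; true] | _ => [] end.

(** The flag of [Loop] records whether this sweep has marked its header. Text is emitted only on
    reading a symbol or at the end of a sweep, so [Out0] emits [pre] along with the first symbol. *)
Definition strans (q : mode) (s : tsym) : mode * list bool :=
  match q, s with
  | Loop i false, H => (Loop i true, code3 G)
  | Loop i true, V => (Loop i true, code3 V ++ code3 U)
  | Reset i, s => (Reset i, code3 (reset s))
  | Expand, s => (Expand, codes (expand s))
  | Out0, s => (Out1, pre ++ out s)
  | Out1, s => (Out1, out s)
  | q, s => (q, code3 s)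
  end.

(** Loops [S k] down to 1 multiply the padding, with resets in between; the last of these
    multiplications is completed by [Expand]. Loop 0 fills the slots of the templates. *)
Definition next (i : nat) : mode :=
  match i with 0 => Out0 | 1 => Expand | S i => Reset i end.

Definition slast (q : mode) : mode * list bool :=
  match q with
  | Raw => (Loop (S k) false, codes (repeat V r0))
  | Loop i true => (Loop i false, [])
  | Loop i false => (next i, [])
  | Reset i => (Loop i false, [])
  | Expand => (Loop 0 false, [])
  | Out0 | Out1 => (Halt, post)
  | Halt => (Halt, [])
  end.

Definition qstate : Type := (mode * list bool)%type.

(** The raw input has one bit per symbol; all later words are read in groups of three, with at most
    two bits buffered. *)
Definition qtrans (q : qstate) (b : bool) : qstate * list bool :=
  match q with
  | (Raw, _) => ((Raw, []), code3 H ++ code3 (K b))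
  | (q, [b1; b2]) => let (q', w) := strans q (decode3 b1 b2 b) in ((q', []), w)
  | (q, []) => ((q, [b]), [])
  | (q, b1 :: _) => ((q, [b1; b]), [])
  end.

Definition qlast (q : qstate) : qstate * list bool :=
  let (q', w) := slast (fst q) in ((q', []), w).

Definition qstop (q : qstate) : bool := match q with (Halt, _) => true | _ => false end.

Definition qmodes : list mode :=
  [Raw; Expand; Out0; Out1; Halt] ++
  flat_map (fun i => [Loop i true; Loop i false; Reset i]) (seq 0 (k + 2)).

Definition qstates : list qstate := list_prod qmodes (flat_map all_inputs [0; 1; 2]).

Definition qwidth : nat :=
  6 + length pre + length post + 3 * r0
  + list_max (map (fun y => length (codes (H :: tpl y))) [None; Some true; Some false]).

Definition mode_ok (q : mode) : Prop :=
  match q with Loop i _ | Reset i => i <= S k | _ => True end.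

Lemma in_qmodes q : In q qmodes <-> mode_ok q.
Proof.
  unfold qmodes. rewrite in_app_iff, in_flat_map. split.
  - intros [I|(i & Hi & I)].
    + simpl in I. intuition; subst; exact Logic.I.
    + apply in_seq in Hi. simpl in I. intuition; subst; simpl; lia.
  - destruct q; simpl; auto 10; intros I; right; exists i; (split; [apply in_seq; lia|]);
      try destruct visited; auto.
Qed.

Lemma in_qstates q buf : In (q, buf) qstates <-> mode_ok q /\ In buf (flat_map all_inputs [0; 1; 2]).
Proof. unfold qstates. rewrite in_prod_iff, in_qmodes. reflexivity. Qed.

Lemma length_tpl_le y : length (codes (H :: tpl y)) <=
  list_max (map (fun y => length (codes (H :: tpl y))) [None; Some true; Some false]).
Proof.
  pose proof (proj1 (list_max_le (map (fun y => length (codes (H :: tpl y))) [None; Some true; Some false]) _)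
    (Nat.le_refl _)) as F.
  rewrite Forall_forall in F. apply F, in_map_iff. exists y. split; [reflexivity|].
  destruct y as [[|]|]; simpl; auto.
Qed.

Lemma strans_ok q s : mode_ok q ->
  mode_ok (fst (strans q s)) /\ length (snd (strans q s)) <= qwidth.
Proof.
  intros Ok. unfold qwidth.
  pose proof (length_tpl_le None). pose proof (length_tpl_le (Some true)). pose proof (length_tpl_le (Some false)).
  set (M := list_max _) in *. clearbody M.
  destruct q as [|i [|]|i| | | |], s as [[|]| | | |]; cbn [strans fst snd mode_ok] in *;
    (split; [exact Ok || exact Logic.I|]); cbn [expand out]; rewrite ?length_app; simpl in *; lia.
Qed.

Lemma slast_ok q : mode_ok q -> mode_ok (fst (slast q)) /\ length (snd (slast q)) <= qwidth.
Proof.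
  unfold qwidth. destruct q as [|i [|]|i| | | |]; simpl; intros Ok; try (split; [exact Ok || exact Logic.I|]; simpl; lia);
    try (split; lia).
  - split; [lia|]. rewrite length_codes, repeat_length. simpl. lia.
  - split; [|lia]. destruct i as [|[|i]]; simpl in *; auto; lia.
Qed.

Lemma qtrans_ok q b : In q qstates ->
  In (fst (qtrans q b)) qstates /\ length (snd (qtrans q b)) <= qwidth.
Proof.
  destruct q as [q buf]. rewrite in_qstates. intros [Ok Hb].
  assert (D : q = Raw \/ q <> Raw) by (destruct q; auto; right; discriminate).
  destruct D as [->|D].
  - split; [apply in_qstates; simpl; auto|]. unfold qwidth; simpl; lia.
  - assert (E : qtrans (q, buf) b = match buf with
        | [b1; b2] => let (q', w) := strans q (decode3 b1 b2 b) in ((q', []), w)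
        | [] => ((q, [b]), [])
        | b1 :: _ => ((q, [b1; b]), [])
        end) by (destruct q; try congruence; reflexivity).
    rewrite E. clear E.
    assert (W : 0 <= qwidth) by lia.
    destruct buf as [|b1 [|b2 [|]]]; cbn [fst snd length]; rewrite ?in_qstates.
    + split; [split; [exact Ok|destruct b; simpl; auto]|exact W].
    + split; [split; [exact Ok|destruct b1, b; simpl; auto 10]|exact W].
    + pose proof (strans_ok q (decode3 b1 b2 b) Ok) as S. destruct (strans q _) as [q' w].
      cbn [fst snd] in *. rewrite in_qstates. simpl; tauto.
    + simpl in Hb. repeat (destruct Hb as [Hb|Hb]; [discriminate|]). destruct Hb.
Qed.

Lemma qlast_ok q : In q qstates -> In (fst (qlast q)) qstates /\ length (snd (qlast q)) <= qwidth.
Proof.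
  destruct q as [q buf]. rewrite in_qstates. intros [Ok _].
  pose proof (slast_ok q Ok) as S. unfold qlast. cbn [fst]. destruct (slast q) as [q' w].
  cbn [fst snd] in *. rewrite in_qstates. simpl; tauto.
Qed.

Definition qstate_eq_dec (p q : qstate) : {p = q} + {p <> q}.
Proof. repeat decide equality. Defined.

Fixpoint ssweep (q : mode) (l : list tsym) : mode * list bool :=
  match l with
  | [] => slast q
  | s :: l => let (q1, w) := strans q s in let (q2, y) := ssweep q1 l in (q2, w ++ y)
  end.

Notation qsweep := (sweep qstate qtrans qlast).
Notation qsweeps := (sweeps qstate qtrans qlast qstop).

Lemma qsweep_codes l : forall q, q <> Raw ->
  qsweep (q, []) (codes l) = let (q', y) := ssweep q l in ((q', []), y).
Proof.
  induction l as [|s l IH]; intros q Hq.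
  - simpl. unfold qlast. reflexivity.
  - assert (E : qsweep (q, []) (codes (s :: l)) =
      let (q1, w) := strans q s in let (q2, y) := qsweep (q1, []) (codes l) in (q2, w ++ y)).
    { assert (X : forall q' b, q' <> Raw -> qtrans (q', []) b = ((q', [b]), [])) by (intros []; congruence || reflexivity).
      assert (Y : forall q' b1 b, q' <> Raw -> qtrans (q', [b1]) b = ((q', [b1; b]), [])) by (intros []; congruence || reflexivity).
      assert (Z : forall q' b1 b2 b, q' <> Raw -> qtrans (q', [b1; b2]) b =
        let (q1, w) := strans q' (decode3 b1 b2 b) in ((q1, []), w)) by (intros []; congruence || reflexivity).
      change (codes (s :: l)) with (code3 s ++ codes l).
      assert (W : exists b1 b2 b3, code3 s = [b1; b2; b3] /\ decode3 b1 b2 b3 = s).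
      { destruct s as [[|]| | | |]; simpl; do 3 eexists; (split; [reflexivity|reflexivity]). }
      destruct W as (b1 & b2 & b3 & -> & D).
      cbn [app sweep]. rewrite X, Y, Z, D by exact Hq. destruct (strans q s) as [q1 w].
      destruct (sweep qstate qtrans qlast (q1, []) (codes l)). reflexivity. }
    rewrite E. cbn [ssweep].
    assert (R : fst (strans q s) <> Raw)
      by (destruct q as [|i [|]|i| | | |], s; simpl in *; congruence).
    destruct (strans q s) as [q1 w]. rewrite IH by exact R. destruct (ssweep q1 l). reflexivity.
Qed.

(** * The effect of a loop on the word *)

Definition ext (l : list tsym) : list tsym :=
  flat_map (fun s => match s with V => [V; U] | _ => [s] end) l.

Fixpoint mark (l : list tsym) : list tsym :=
  match l with [] => [] | H :: l => G :: ext l | s :: l => s :: mark l end.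

Fixpoint headers (l : list tsym) : nat :=
  match l with [] => 0 | H :: l => S (headers l) | _ :: l => headers l end.

(* The result of a [Loop], where [d] headers come before the word. *)
Fixpoint close (d : nat) (l : list tsym) : list tsym :=
  match l with
  | [] => []
  | H :: l => G :: close (S d) l
  | V :: l => V :: repeat U d ++ close d l
  | s :: l => s :: close d l
  end.

Lemma ssweep_loop_true i l : ssweep (Loop i true) l = (Loop i false, codes (ext l)).
Proof.
  induction l as [|s l IH]; [reflexivity|]. destruct s as [b| | | |]; simpl; rewrite IH; reflexivity.
Qed.

Lemma ssweep_loop_false i l : ssweep (Loop i false) l =
  match headers l with 0 => (next i, codes l) | S _ => (Loop i false, codes (mark l)) end.
Proof.
  induction l as [|s l IH]; [reflexivity|].
  destruct s as [b| | | |]; cbn [ssweep strans headers]; rewrite ?IH, ?ssweep_loop_true;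
    destruct (headers l); reflexivity.
Qed.

Lemma headers_ext l : headers (ext l) = headers l.
Proof. induction l as [|[b| | | |] l IH]; simpl; auto. Qed.

Lemma headers_mark l : headers (mark l) = pred (headers l).
Proof. induction l as [|[b| | | |] l IH]; simpl; auto using headers_ext. Qed.

Lemma close_ext d l : close d (ext l) = close (S d) l.
Proof.
  revert d; induction l as [|[b| | | |] l IH]; intros d; simpl; rewrite ?IH; auto.
  f_equal. change (U :: repeat U d ++ close (S d) l) with ((U :: repeat U d) ++ close (S d) l).
  rewrite repeat_cons, <- app_assoc. reflexivity.
Qed.

(** The final word is invariant under a sweep: the marked header no longer counts, but its digit has
    already been added to every later slot. *)
Lemma close_mark l : close 0 (mark l) = close 0 l.
Proof. induction l as [|[b| | | |] l IH]; simpl; rewrite ?IH, ?close_ext; auto. Qed.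

Lemma close_no_headers l : headers l = 0 -> close 0 l = l.
Proof. induction l as [|[b| | | |] l IH]; simpl; intros E; rewrite ?IH; auto; discriminate. Qed.

Lemma length_close_ge d l : length l <= length (close d l).
Proof.
  revert d; induction l as [|[b| | | |] l IH]; intros d; simpl; try rewrite length_app; auto; try apply le_n_S, IH.
  specialize (IH d); lia.
Qed.

Lemma length_close_le d l : length (close d l) <= length l * (1 + d + length l).
Proof.
  revert d; induction l as [|[b| | | |] l IH]; intros d; cbn [close length]; auto;
    rewrite ?length_app, ?repeat_length; pose proof (IH d); pose proof (IH (S d)); nia.
Qed.

(** Since [close] is invariant under [mark] and never shortens, a bound on the final word bounds all
    words in between. The extra sweep is the one that finds no header. *)
Lemma sweeps_loop B i l : 3 * length (close 0 l) <= B ->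
  qsweeps B (headers l + 1) (Loop i false, []) (codes l) (next i, []) (codes (close 0 l)).
Proof.
  remember (headers l) as h eqn:E. revert l E; induction h as [|h IH]; intros l E HB.
  - rewrite close_no_headers in * by auto.
    apply sweeps_one; try rewrite length_codes; auto.
    rewrite qsweep_codes, ssweep_loop_false, <- E by discriminate. reflexivity.
  - change (S h + 1) with (1 + (h + 1)). eapply sweeps_trans.
    + apply sweeps_one with (q1 := (Loop i false, [])) (y1 := codes (mark l)); [reflexivity| | |].
      * rewrite qsweep_codes, ssweep_loop_false, <- E by discriminate. reflexivity.
      * pose proof (length_close_ge 0 l). rewrite length_codes; lia.
      * pose proof (length_close_ge 0 (mark l)). rewrite close_mark in *. rewrite length_codes; lia.
    + rewrite <- close_mark. apply IH; [rewrite headers_mark, <- E; reflexivity|].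
      rewrite close_mark. exact HB.
Qed.

Lemma ssweep_reset i l : ssweep (Reset i) l = (Loop i false, codes (map reset l)).
Proof. induction l as [|s l IH]; [reflexivity|]. simpl. rewrite IH. reflexivity. Qed.

Lemma ssweep_expand l : ssweep Expand l = (Loop 0 false, codes (flat_map expand l)).
Proof. induction l as [|s l IH]; [reflexivity|]. simpl. rewrite IH, codes_app. reflexivity. Qed.

Lemma ssweep_out1 l : ssweep Out1 l = (Halt, flat_map out l ++ post).
Proof. induction l as [|s l IH]; [reflexivity|]. simpl. rewrite IH, app_assoc. reflexivity. Qed.

Lemma ssweep_out0 s l : ssweep Out0 (s :: l) = (Halt, pre ++ flat_map out (s :: l) ++ post).
Proof. simpl. rewrite ssweep_out1, <- !app_assoc. reflexivity. Qed.

(** * Multiplying the padding *)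

Definition padded (x : list bool) (r : nat) : list tsym :=
  flat_map (fun b => [H; K b]) x ++ repeat V r.

Definition multiplied (x : list bool) (r : nat) : list tsym :=
  flat_map (fun b => [G; K b]) x ++ concat (repeat (V :: repeat U (length x)) r).

Lemma qsweep_raw x : qsweep (Raw, []) x = ((Loop (S k) false, []), codes (padded x r0)).
Proof.
  unfold padded. induction x as [|b x IH]; [reflexivity|].
  cbn [sweep qtrans]. rewrite IH. reflexivity.
Qed.

Lemma headers_padded x r : headers (padded x r) = length x.
Proof.
  unfold padded. induction x as [|b x IH]; simpl; auto. induction r; simpl; auto.
Qed.

Lemma close_padded x r : close 0 (padded x r) = multiplied x r.
Proof.
  assert (E : forall y d, close d (flat_map (fun b => [H; K b]) y ++ repeat V r) =
    flat_map (fun b => [G; K b]) y ++ concat (repeat (V :: repeat U (d + length y)) r)).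
  { induction y as [|b y IH]; intros d; simpl.
    - rewrite Nat.add_0_r. induction r as [|r' IHr]; simpl; [reflexivity|]. rewrite IHr. reflexivity.
    - rewrite IH, Nat.add_succ_r. reflexivity. }
  apply (E x 0).
Qed.

Lemma length_flat_map_const (A B : Type) (f : A -> list B) c l :
  (forall a, length (f a) = c) -> length (flat_map f l) = c * length l.
Proof.
  intros E; induction l as [|a l IH]; simpl; [lia|]. rewrite length_app, E, IH. lia.
Qed.

Lemma length_concat_repeat (A : Type) (l : list A) r : length (concat (repeat l r)) = r * length l.
Proof. induction r as [|r IH]; simpl; [reflexivity|]. rewrite length_app, IH. reflexivity. Qed.

Lemma length_multiplied x r : length (multiplied x r) = 2 * length x + r * S (length x).
Proof.
  unfold multiplied. rewrite length_app, (length_flat_map_const _ _ _ 2) by reflexivity.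
  rewrite length_concat_repeat. simpl. rewrite repeat_length. reflexivity.
Qed.

Lemma length_padded x r : length (padded x r) = 2 * length x + r.
Proof.
  unfold padded. rewrite length_app, (length_flat_map_const _ _ _ 2) by reflexivity.
  rewrite repeat_length. reflexivity.
Qed.

Lemma reset_multiplied x r : map reset (multiplied x r) = padded x (r * S (length x)).
Proof.
  unfold multiplied, padded. rewrite map_app. f_equal.
  - induction x as [|b x IH]; simpl; [reflexivity|]. rewrite IH. reflexivity.
  - induction r as [|r IH]; [reflexivity|].
    cbn [repeat concat Nat.mul]. rewrite map_app, IH, repeat_app. simpl. rewrite map_repeat. reflexivity.
Qed.

Definition blocks (x : list bool) (r : nat) : list (option bool) := map Some x ++ repeat None r.

Definition template_word (ys : list (option bool)) : list tsym := flat_map (fun y => H :: tpl y) ys.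

Lemma expand_multiplied x r :
  flat_map expand (multiplied x r) = template_word (blocks x (r * S (length x))).
Proof.
  unfold multiplied, template_word, blocks. rewrite !flat_map_app. f_equal.
  - induction x as [|b x IH]; simpl; [reflexivity|]. rewrite IH. reflexivity.
  - assert (E : forall n, flat_map expand (repeat U n) = flat_map (fun y => H :: tpl y) (repeat None n)).
    { induction n as [|n IH]; simpl; [reflexivity|]. rewrite IH. reflexivity. }
    induction r as [|r IH]; [reflexivity|].
    cbn [repeat concat Nat.mul]. rewrite repeat_app, !flat_map_app, <- IH. simpl. rewrite E. reflexivity.
Qed.

(** A phase costs one sweep per input bit, one that finds no header, and at most one reset. The
    length hypothesis concerns the last and longest word. *)
Lemma sweeps_multiply B x i : forall r,
  3 * (2 * length x + r * S (length x) ^ S i) <= B ->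
  exists n, n <= (i + 1) * (length x + 2) /\
  qsweeps B n (Loop (S i) false, []) (codes (padded x r))
    (Expand, []) (codes (multiplied x (r * S (length x) ^ i))).
Proof.
  assert (Base : forall j r, 3 * (2 * length x + r * S (length x)) <= B ->
    qsweeps B (length x + 1) (Loop j false, []) (codes (padded x r)) (next j, []) (codes (multiplied x r))).
  { intros j r HB. rewrite <- close_padded, <- (headers_padded x r).
    apply sweeps_loop. rewrite close_padded, length_multiplied. exact HB. }
  induction i as [|i IH]; intros r HB.
  - exists (length x + 1). split; [lia|]. rewrite Nat.pow_0_r, Nat.mul_1_r.
    apply (Base 1). rewrite Nat.pow_1_r in HB. exact HB.
  - destruct (IH (r * S (length x))) as (n & Hn & Sw).
    { rewrite <- Nat.mul_assoc, <- Nat.pow_succ_r'. exact HB. }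
    assert (P : 1 <= S (length x) ^ S i) by (pose proof (Nat.pow_nonzero (S (length x)) (S i)); lia).
    assert (HB' : 3 * (2 * length x + r * S (length x)) <= B).
    { etransitivity; [|exact HB]. rewrite (Nat.pow_succ_r' _ (S i)). nia. }
    exists ((length x + 1) + (1 + n)). split; [nia|].
    eapply sweeps_trans; [apply Base, HB'|]. cbn [next].
    eapply sweeps_trans.
    + apply sweeps_one with (q1 := (Loop (S i) false, []))
        (y1 := codes (padded x (r * S (length x)))); [reflexivity| | |].
      * rewrite qsweep_codes, ssweep_reset, reset_multiplied by discriminate. reflexivity.
      * rewrite length_codes, length_multiplied. exact HB'.
      * rewrite length_codes, length_padded. exact HB'.
    + rewrite (Nat.pow_succ_r' _ i), Nat.mul_assoc. exact Sw.
Qed.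

(** * Templates with filled slots *)

Definition inst (d : nat) (l : list tsym) : list bool :=
  flat_map (fun s => match s with K b => [b] | V => concat (repeat [true; true] d) | _ => [] end) l.

Lemma inst_app d l l' : inst d (l ++ l') = inst d l ++ inst d l'.
Proof. apply flat_map_app. Qed.

Lemma out_repeat_U d : flat_map out (repeat U d) = concat (repeat [true; true] d).
Proof. induction d as [|d IH]; simpl; [reflexivity|]. rewrite IH. reflexivity. Qed.

(** A template contains no header, so the count [d] is constant across it. *)
Lemma out_close_template d l r : KV l ->
  flat_map out (close d (l ++ r)) = inst d l ++ flat_map out (close d r).
Proof.
  induction 1 as [|s l Hs _ IH]; [reflexivity|].
  destruct s; try tauto; simpl.
  - rewrite IH. reflexivity.
  - rewrite flat_map_app, IH, out_repeat_U, <- app_assoc. reflexivity.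
Qed.

(** The header of a block counts for its own slots, so block j gets j + 1 digits. This matches the
    [S i] in [name], whose first [true] also tells ring cells from control variables. *)
Fixpoint inst_from (d : nat) (ys : list (option bool)) : list bool :=
  match ys with [] => [] | y :: ys => inst (S d) (tpl y) ++ inst_from (S d) ys end.

Lemma out_close_blocks ys : forall d, flat_map out (close d (template_word ys)) = inst_from d ys.
Proof.
  induction ys as [|y ys IH]; intros d; [reflexivity|].
  unfold template_word. simpl. rewrite out_close_template by apply tpl_KV.
  f_equal. apply IH.
Qed.

Lemma headers_template_word ys : headers (template_word ys) = length ys.
Proof.
  unfold template_word. induction ys as [|y ys IH]; [reflexivity|]. simpl. f_equal. rewrite <- IH.
  induction (tpl_KV y) as [|s l Hs _ IHl]; [reflexivity|]. destruct s; try tauto; exact IHl.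
Qed.

Lemma length_template_word ys : length (template_word ys) <= length ys * qwidth.
Proof.
  unfold template_word. induction ys as [|y ys IH]; [simpl; lia|].
  cbn [flat_map length]. rewrite length_app.
  pose proof (length_tpl_le y) as L. rewrite length_codes in L. cbn [length] in *.
  assert (S (length (tpl y)) <= qwidth) by (unfold qwidth; set (M := list_max _) in *; clearbody M; lia).
  cbn [Nat.mul]. lia.
Qed.

Definition generate (x : list bool) : list bool :=
  pre ++ inst_from 0 (blocks x (r0 * S (length x) ^ S k)) ++ post.

Hypothesis r0_pos : 0 < r0.

Definition nblocks (n : nat) : nat := n + r0 * S n ^ S k.
Definition tape_bound (n : nat) : nat :=
  length pre + length post + 6 * nblocks n + 3 * (nblocks n * qwidth * (1 + nblocks n * qwidth)).

Lemma sweeps_generate x : exists n,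
  n <= (k + 1) * (length x + 2) + nblocks (length x) + 4 /\
  qsweeps (tape_bound (length x)) n (Raw, []) x (Halt, []) (generate x).
Proof.
  set (B := tape_bound (length x)). set (m := nblocks (length x)).
  set (ys := blocks x (r0 * S (length x) ^ S k)).
  assert (Lys : length ys = m).
  { unfold ys, blocks, m, nblocks. rewrite length_app, length_map, repeat_length. reflexivity. }
  assert (Hm : length x + r0 * S (length x) ^ S k = m) by reflexivity.
  assert (HB : length pre + length post + 6 * m + 3 * (m * qwidth * (1 + m * qwidth)) = B) by reflexivity.
  assert (P : 1 <= S (length x) ^ S k) by (pose proof (Nat.pow_nonzero (S (length x)) (S k)); lia).
  assert (Hr : r0 <= r0 * S (length x) ^ S k) by nia.
  destruct (sweeps_multiply B x k r0) as (n1 & Hn1 & Sw1); [lia|].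
  set (Z := close 0 (template_word ys)).
  assert (LT : length (template_word ys) <= m * qwidth) by (rewrite <- Lys; apply length_template_word).
  assert (LZ : length Z <= m * qwidth * (1 + m * qwidth)).
  { etransitivity; [apply length_close_le|]. apply Nat.mul_le_mono; lia. }
  assert (LT' : length (template_word ys) <= length Z) by apply length_close_ge.
  assert (E0 : qsweep (Raw, []) x = ((Loop (S k) false, []), codes (padded x r0))) by apply qsweep_raw.
  (* One raw sweep, the multiplication, one expansion, one sweep for each of the [m] headers and one
     that finds none, one output sweep. *)
  exists (1 + (n1 + (1 + ((m + 1) + 1)))). split; [unfold m in *; lia|].
  eapply sweeps_trans; [eapply sweeps_one; [reflexivity|exact E0|lia|]|].
  { rewrite length_codes, length_padded. lia. }
  eapply sweeps_trans; [exact Sw1|].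
  eapply sweeps_trans.
  { apply sweeps_one with (q1 := (Loop 0 false, [])) (y1 := codes (template_word ys)); [reflexivity| | |].
    - rewrite qsweep_codes, ssweep_expand, expand_multiplied by discriminate.
      unfold ys. rewrite <- Nat.mul_assoc, (Nat.mul_comm (_ ^ k)), <- Nat.pow_succ_r'. reflexivity.
    - rewrite length_codes, length_multiplied, <- Nat.mul_assoc, (Nat.mul_comm (_ ^ k)), <- Nat.pow_succ_r'. lia.
    - rewrite length_codes. lia. }
  eapply sweeps_trans.
  { rewrite <- Lys, <- headers_template_word. apply sweeps_loop. fold Z. lia. }
  fold Z. cbn [next].
  (* As [pre] comes with the first symbol, the word must not be empty; [r0_pos] provides a block. *)
  assert (EZ : exists s Z', Z = s :: Z').
  { unfold Z. destruct ys as [|y ys']; [simpl in Lys; lia|]. simpl. eauto. }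
  assert (EO : ssweep Out0 Z = (Halt, generate x)).
  { destruct EZ as (s & Z' & E). rewrite E, ssweep_out0, <- E. unfold Z. rewrite out_close_blocks. reflexivity. }
  apply sweeps_one; [reflexivity| | |].
  - rewrite qsweep_codes, EO by discriminate. reflexivity.
  - rewrite length_codes. lia.
  - unfold generate. fold ys. rewrite <- (out_close_blocks ys 0). fold Z. rewrite !length_app.
    assert (LO : forall l, length (flat_map out l) <= 2 * length l).
    { induction l as [|[b| | | |] l IH]; simpl; lia. }
    specialize (LO Z). lia.
Qed.

Theorem generate_poly_time : poly_time_computable generate.
Proof.
  assert (PM : poly nblocks).
  { apply poly_add; [apply poly_id|]. apply poly_mul; [apply poly_const|].
    apply poly_pow. apply (poly_add (fun _ => 1) (fun n => n)); [apply poly_const|apply poly_id]. }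
  assert (PW : poly (fun n => nblocks n * qwidth)) by (apply poly_mul; [exact PM|apply poly_const]).
  apply (sweeps_poly_time qstate qstate_eq_dec qstates qtrans qlast (Raw, []) qstop qwidth)
    with (N := fun n => (k + 1) * (n + 2) + nblocks n + 4) (B := tape_bound).
  - apply in_qstates. simpl; auto.
  - exact qtrans_ok.
  - exact qlast_ok.
  - apply poly_add; [|apply poly_const]. apply poly_add; [|exact PM].
    apply poly_mul; [apply poly_const|]. apply poly_add; [apply poly_id|apply poly_const].
  - apply poly_add; [apply poly_add; [apply poly_const|]|].
    + apply poly_mul; [apply poly_const|exact PM].
    + apply poly_mul; [apply poly_const|]. apply poly_mul; [exact PW|].
      apply poly_add; [apply poly_const|exact PW].
  - intros x. destruct (sweeps_generate x) as (n & Hn & Sw).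
    exists n, (Halt, []). auto.
Qed.
End Transducer.

(** * Templates for the code of a block *)

Definition bits_syms (l : list bool) : list tsym := map K l.

(** The first [true] is the nonzero flag of [enc_nat]. For the next cell, two further bits write one
    more unary digit, so the same slot count serves both cells. *)
Definition template_name (x : nat) : list tsym :=
  match x with
  | 0 => K true :: V :: bits_syms (enc_bits [false; false])
  | 1 => K true :: V :: bits_syms (enc_bits [false; true])
  | 2 => bits_syms [true; true; true] ++ V :: bits_syms (enc_bits [false; false])
  | 3 => bits_syms [true; true; true] ++ V :: bits_syms (enc_bits [false; true])
  | S (S (S (S k))) => bits_syms (true :: enc_bits (name (Cst k)))
  end.

Fixpoint template_expr (e : bexpr) : list tsym :=
  match e with
  | BTrue => bits_syms [false; false]
  | BVar x => bits_syms [false; true] ++ template_name x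
  | BAnd a b => bits_syms [true; false] ++ template_expr a ++ template_expr b
  | BNot a => bits_syms [true; true] ++ template_expr a
  end.

Fixpoint template_prog (M : bprog) : list tsym :=
  match M with
  | PAssign x e => bits_syms [false; false; false] ++ template_name x ++ template_expr e
  | PSeq M0 M1 => bits_syms [false; false; true] ++ template_prog M0 ++ template_prog M1
  | PIf e M0 M1 => bits_syms [false; true; false] ++ template_expr e ++ template_prog M0 ++ template_prog M1
  | PWhile e M0 => bits_syms [false; true; true] ++ template_expr e ++ template_prog M0
  | PSkip => bits_syms [true; false; false]
  end.

Lemma inst_bits d l : inst d (bits_syms l) = l.
Proof. induction l as [|b l IH]; [reflexivity|]. simpl. f_equal. exact IH. Qed.

Lemma enc_bits_repeat_true d l : enc_bits (repeat true d ++ l) = concat (repeat [true; true] d) ++ enc_bits l.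
Proof. induction d as [|d IH]; [reflexivity|]. unfold enc_bits in *. simpl. rewrite IH. reflexivity. Qed.

Lemma inst_template_name j x : inst (S j) (template_name x) = enc_nat (vn (template_var j x)).
Proof.
  rewrite enc_vn. destruct x as [|[|[|[|x]]]].
  5: apply inst_bits.
  all: cbn [template_var name]; rewrite enc_bits_repeat_true; reflexivity.
Qed.

Lemma inst_template_expr j e :
  inst (S j) (template_expr e) = enc_bexpr (ren_expr (fun x => vn (template_var j x)) e).
Proof.
  induction e as [|x|a IHa b IHb|a IHa]; cbn [template_expr ren_expr enc_bexpr];
    rewrite ?inst_app, ?inst_bits, ?inst_template_name, ?IHa, ?IHb; reflexivity.
Qed.

Lemma inst_template_prog j M :
  inst (S j) (template_prog M) = enc_bprog (ren (fun x => vn (template_var j x)) M).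
Proof.
  induction M as [x e|M0 IH0 M1 IH1|e M0 IH0 M1 IH1|e M0 IH0|]; cbn [template_prog ren enc_bprog];
    rewrite ?inst_app, ?inst_bits, ?inst_template_name, ?inst_template_expr, ?IH0, ?IH1; reflexivity.
Qed.

Lemma KV_bits l : KV (bits_syms l).
Proof. apply Forall_map, Forall_forall. intros b _. repeat split; discriminate. Qed.

Lemma KV_app l l' : KV l -> KV l' -> KV (l ++ l').
Proof. intros; apply Forall_app; auto. Qed.

Lemma KV_template_name x : KV (template_name x).
Proof.
  destruct x as [|[|[|[|x]]]].
  5: apply KV_bits.
  all: repeat constructor; discriminate.
Qed.

Lemma KV_template_expr e : KV (template_expr e).
Proof. induction e; cbn [template_expr]; auto using KV_bits, KV_app, KV_template_name. Qed.

Lemma KV_template_prog M : KV (template_prog M).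
Proof.
  induction M; cbn [template_prog]; auto using KV_bits, KV_app, KV_template_name, KV_template_expr.
Qed.

(** * The reduction *)

Section Reduction.
Variables (T : TM) (r0 k : nat).

Definition secret : nat := vn (Cst 0).
Definition public : nat := vn (Cst 1).

Definition reduction_instance (ys : list (option bool)) : instance :=
  mkInstance (leak (simulator T ys) (vn (vQ (tm_accept T))) secret public) [secret] [public] (0 # 1).

Definition block_word (y : option bool) : list tsym :=
  bits_syms [false; false; true] ++ template_prog (block_template y).

Definition prefix : list bool :=
  [false; false; true] ++ [false; false; true] ++ enc_bprog (set (vQ (tm_start T)) true) ++
  [false; false; true] ++ enc_bprog (set vLd true) ++
  [false; true; true] ++ enc_bexpr (running T) ++
  [false; false; true] ++ enc_bprog (control T) ++ [false; false; true].

Definition suffix : list bool :=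
  enc_bprog PSkip ++ enc_bprog finish ++
  enc_bprog (PIf (BVar (vn (vQ (tm_accept T)))) (PAssign public (BVar secret)) PSkip) ++
  enc_natlist [secret] ++ enc_natlist [public] ++ enc_Q (0 # 1).

(** In preorder, a right-nested sequence is the concatenation of its blocks, each preceded by a
    [PSeq] tag; hence the tag in [block_word] and the closing [PSkip] in [suffix]. *)
Lemma enc_pass_from ys : forall j,
  enc_bprog (pass_from j ys) = inst_from block_word j ys ++ enc_bprog PSkip.
Proof.
  induction ys as [|y ys IH]; intros j; [reflexivity|].
  cbn [pass_from enc_bprog inst_from]. unfold block_word at 1.
  rewrite IH, inst_app, inst_bits, inst_template_prog, <- !app_assoc. reflexivity.
Qed.

Lemma enc_reduction_instance ys :
  enc_instance (reduction_instance ys) = prefix ++ inst_from block_word 0 ys ++ suffix.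
Proof.
  unfold enc_instance, reduction_instance, leak, simulator, body, prefix, suffix.
  cbn [i_prog i_high i_low i_q enc_bprog]. rewrite enc_pass_from. rewrite <- !app_assoc. reflexivity.
Qed.

Lemma SE_reduction x r t :
  let ys := blocks x r in
  tm_wf T -> (forall u, space (tm_run T (init_config T x) u) <= S (length ys)) ->
  halted T (tm_run T (init_config T x) t) ->
  SE (reduction_instance ys) =
    if c_state (tm_run T (init_config T x) t) =? tm_accept T then 1%R else 0%R.
Proof.
  intros ys wf Sp Ht.
  destruct (evals_simulator T wf x r false t Sp Ht) as (s' & E & O).
  unfold reduction_instance. rewrite (SE_leak _ _ _ _ _ (fresh_simulator T ys)) with (s' := s').
  - rewrite O, Nat.eqb_sym. reflexivity.
  - apply vn_neq; discriminate.
  - apply vn_neq; discriminate.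
  - exact E.
Qed.
End Reduction.

Theorem theorem15 : PSPACE_hard SE_gt_problem.
Proof.
  intros L (T & c & k & wf & HL).
  (* For input length n, c n^k + c <= 2 c (n + 1)^(k + 1); the successor keeps [r0] positive when
     [c = 0]. The exponent is k + 1 because the expansion always multiplies once. *)
  set (r0 := S (2 * c)).
  set (ys := fun x => blocks x (r0 * S (length x) ^ S k)).
  exists (generate block_word (prefix T) (suffix T) r0 k). split.
  { apply generate_poly_time; [|unfold r0; lia].
    intros y. apply KV_app; [apply KV_bits|apply KV_template_prog]. }
  intros x. destruct (HL x) as (Sp & t & Ht & Acc).
  assert (E : generate block_word (prefix T) (suffix T) r0 k x = enc_instance (reduction_instance T (ys x))).
  { rewrite enc_reduction_instance. reflexivity. }
  assert (Space : forall u, space (tm_run T (init_config T x) u) <= S (length (ys x))).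
  { intros u. etransitivity; [apply Sp|]. unfold poly_bound, ys, blocks.
    rewrite length_app, length_map, repeat_length.
    assert (P : length x ^ k <= S (length x) ^ S k).
    { transitivity (S (length x) ^ k); [apply Nat.pow_le_mono_l; lia|apply Nat.pow_le_mono_r; lia]. }
    assert (P1 : 1 <= S (length x) ^ S k) by (pose proof (Nat.pow_nonzero (S (length x)) (S k)); lia).
    unfold r0. nia. }
  pose proof (SE_reduction T x _ t wf Space Ht) as SEx.
  fold (ys x) in SEx. rewrite E, <- Acc.
  assert (Q0 : Q2R (0 # 1) = 0%R) by (unfold Q2R; simpl; lra).
  split.
  - intros A. exists (reduction_instance T (ys x)). split; [|split; [reflexivity|]].
    + split; repeat constructor; simpl; tauto.
    + rewrite SEx, A, Nat.eqb_refl. cbn [i_q reduction_instance]. rewrite Q0. lra.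
  - intros (I & _ & EI & G). apply enc_instance_inj in EI. subst I.
    rewrite SEx in G. cbn [i_q reduction_instance] in G. rewrite Q0 in G.
    destruct (Nat.eqb_spec (c_state (tm_run T (init_config T x) t)) (tm_accept T)); [assumption|lra].
Qed.
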